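(* Let $n\geq3$ and let $S_n$ act on $V=\mathbb{C}^n$ by the natural permutation representation $\sigma e_i=e_{\sigma(i)}$. For $a,b,c\in\mathbb{C}$ and $1\leq i<j\leq n$ let $$\kappa^L(e_i,e_j)=\sum_{k\neq i,j}\big(a\,e_{\{i,j,k\}}+b\,e^{\perp}_{\{i,j,k\}}\big)\otimes\big((ijk)-(kji)\big),$$ $$\kappa^C(e_i,e_j)=c\sum_{k\neq i,j}\big((ijk)-(kji)\big)+(a-b)^2\Big(\sum_{\substack{\sigma\text{ a }5\text{-cycle}\\ \sigma^2(i)=j}}2(\sigma-\sigma^{-1})-\sum_{\substack{\sigma\text{ a }5\text{-cycle}\\ \sigma(i)=j}}(\sigma-\sigma^{-1})\Big).$$ Then $$\mathcal{H}_{\kappa,t}=T(V)\#S_n[t]\big/\langle e_ie_j-e_je_i-\kappa^L(e_i,e_j)t-\kappa^C(e_i,e_j)t^2\mid 1\leq i<j\leq n\rangle$$ is a Drinfeld orbifold algebra over $\mathbb{C}[t]$. Further, the algebras $\mathcal{H}_{\kappa,1}$ are precisely the Drinfeld orbifold algebras $\mathcal H_\kappa$ for this action such that $\operatorname{im}\kappa^L_g\subseteq V^g$ for each $g\in S_n$ and $\kappa^L$ is supported only off the identity.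
   Context: Notation: $e_1,\dots,e_n$ is the standard basis; for $I\subseteq\{1,\dots,n\}$, $e_I=\sum_{i\in I}e_i$ and $e_I^\perp=e_{\{1,\dots,n\}}-e_I$; $(ijk)$ denotes a 3-cycle; $V^g$ is the fixed-point space of $g$. The maps $\kappa^L,\kappa^C$ are extended to alternating bilinear maps on $V$. For a finite group $G$ acting linearly on $V$, the skew group algebra $R\#G$ ($R=T(V)$ or $S(V)$) is $R\otimes\mathbb{C}G$ with $(r\otimes g)(s\otimes h)=r(g\cdot s)\otimes gh$. A linear (resp. constant) $2$-cochain is $\alpha=\sum_g\alpha_g g$ with $\alpha_g:\bigwedge^2V\to V$ (resp. $\to\mathbb{C}$); $\alpha(v,w)=\sum_g\alpha_g(v,w)\otimes g$; its support is $\{g:\alpha_g\ne0\}$. For $\kappa=\kappa^L+\kappa^C$, $\mathcal{H}_\kappa=T(V)\#G/\langle vw-wv-\kappa^L(v,w)-\kappa^C(v,w)\mid v,w\in V\rangle$, filtered with $V$ in degree one and $G$ in degree zero; it is a Drinfeld orbifold algebra if its associated graded algebra is isomorphic to $S(V)\#G$. When $\mathcal{H}_\kappa$ is a Drinfeld orbifold algebra, $\mathcal{H}_{\kappa,t}=T(V)\#G[t]/\langle vw-wv-\kappa^L(v,w)t-\kappa^C(v,w)t^2\rangle$ is called a Drinfeld orbifold algebra over $\mathbb{C}[t]$. *)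

(* Defs.v *)
From HB Require Import structures.
From mathcomp Require Import all_boot all_order all_algebra all_fingroup.
From mathcomp Require Import complex reals.
Set Implicit Arguments. Unset Strict Implicit. Unset Printing Implicit Defensive.
Import GRing.Theory.
Local Open Scope ring_scope.

Section DOA.
Variables (K : fieldType) (n : nat).

(* Group elements: permutations of 'I_n (= S_n).  A permutation g is the
   function i |-> g i, acting by g . e_i = e_(g i).  The product g h of the
   paper (composition g o h) is the MathComp product (h * g)%g. *)

(* A basis monomial of T(V)#G: e_(w_1) ... e_(w_k) (x) g. *)
Definition mon := (seq 'I_n * {perm 'I_n})%type.

(* (x (x) g)(y (x) h) = x (g.y) (x) gh *)
Definition monmul (m1 m2 : mon) : mon :=
  (m1.1 ++ map (fun i => m1.2 i) m2.1, (m2.2 * m1.2)%g).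

(* Elements of T(V)#G as formal finite linear combinations of monomials. *)
Definition elt := seq (K * mon).

Definition coef (f : elt) (m : mon) : K := \sum_(p <- f | p.2 == m) p.1.

Definition scale (a : K) (f : elt) : elt := [seq (a * p.1, p.2) | p <- f].
Definition esub (f g : elt) : elt := f ++ scale (-1) g.
Definition emul (f g : elt) : elt :=
  [seq (p.1 * q.1, monmul p.2 q.2) | p <- f, q <- g].

(* A linear 2-cochain kL : kL g i j l = coefficient of e_l in kL_g(e_i,e_j);
   a constant 2-cochain kC : kC g i j = kC_g(e_i,e_j). *)
Definition alternatingL (kL : {perm 'I_n} -> 'I_n -> 'I_n -> 'I_n -> K) :=
  forall g i j l, kL g i i l = 0 /\ kL g j i l = - kL g i j l.
Definition alternatingC (kC : {perm 'I_n} -> 'I_n -> 'I_n -> K) :=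
  forall g i j, kC g i i = 0 /\ kC g j i = - kC g i j.

Variables (kL : {perm 'I_n} -> 'I_n -> 'I_n -> 'I_n -> K)
          (kC : {perm 'I_n} -> 'I_n -> 'I_n -> K).

Definition rel (i j : 'I_n) : elt :=
  [:: (1, ([:: i; j], 1%g)); (-1, ([:: j; i], 1%g))]
  ++ [seq (- kL g i j l, ([:: l], g)) | g <- enum {perm 'I_n}, l <- enum 'I_n]
  ++ [seq (- kC g i j, ([::], g)) | g <- enum {perm 'I_n}].

Definition in_ideal (f : elt) : Prop :=
  exists s : seq ((K * mon) * (('I_n * 'I_n) * mon)),
    forall m, coef f m =
      coef (flatten [seq scale x.1.1
                 (emul [:: (1, x.1.2)] (emul (rel x.2.1.1 x.2.1.2) [:: (1, x.2.2)]))
               | x <- s]) m.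

(* filtration: V in degree one, G in degree zero; f has degree < d *)
Definition deg_lt (d : nat) (f : elt) : Prop :=
  forall m, (d <= size m.1)%N -> coef f m = 0.

(* f lies in S^d(V) (x) KG: supported on ordered monomials of degree d *)
Definition ordered_deg (d : nat) (f : elt) : Prop :=
  forall m, coef f m != 0 ->
    sorted (fun i j : 'I_n => (i <= j)%N) m.1 /\ size m.1 = d.

(* H_kappa is a Drinfeld orbifold algebra: the natural (always surjective)
   graded algebra map S(V)#G -> gr H_kappa, sending an ordered monomial to
   the class of the same monomial in F_d H / F_(d-1) H, is injective
   (hence an isomorphism). *)
Definition DOA : Prop :=
  forall (d : nat) (f : elt), ordered_deg d f ->
    (exists f' : elt, deg_lt d f' /\ in_ideal (esub f f')) ->
    forall m, coef f m = 0.

End DOA.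

Section Kappa.
Variables (K : fieldType) (n : nat).

Definition is_cyc3 (i j k : 'I_n) (g : {perm 'I_n}) : bool :=
  [&& g i == j, g j == k, g k == i &
      [forall l, (l \notin [:: i; j; k]) ==> (g l == l)]].

Definition is_cyc5 (g : {perm 'I_n}) : bool :=
  [exists x, #|porbit g x| == 5]%N && (#|[set x | g x != x]| == 5)%N.

Definition kappaL (a b : K) (g : {perm 'I_n}) (i j l : 'I_n) : K :=
  if i == j then 0 else
  \sum_(k < n | (k != i) && (k != j))
     ((is_cyc3 i j k g)%:R - (is_cyc3 k j i g)%:R) *
     (if l \in [:: i; j; k] then a else b).

Definition kappaC (a b c : K) (g : {perm 'I_n}) (i j : 'I_n) : K :=
  if i == j then 0 else
  c * (\sum_(k < n | (k != i) && (k != j))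
         ((is_cyc3 i j k g)%:R - (is_cyc3 k j i g)%:R))
  + (a - b) ^+ 2 *
    (2 * ((is_cyc5 g && (g (g i) == j))%:R
          - (is_cyc5 (g^-1)%g && ((g^-1)%g ((g^-1)%g i) == j))%:R)
     - ((is_cyc5 g && (g i == j))%:R - (is_cyc5 (g^-1)%g && ((g^-1)%g i == j))%:R)).

End Kappa.

(* Main.v *)
Require Import Defs.
From HB Require Import structures.
From mathcomp Require Import all_boot all_order all_algebra all_fingroup.
From mathcomp Require Import complex reals.
From mathcomp Require Import ring zify.
Set Implicit Arguments. Unset Strict Implicit. Unset Printing Implicit Defensive.
Import GRing.Theory Num.Theory.
Local Open Scope ring_scope.

(** Write [kappa(v,w)] for the right-hand side of the commutation relations.  The
algebra has the PBW property iff kappa is S_n-invariant and the Jacobi elements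
[[kappa(e_i,e_j), e_l] + cyclic] vanish modulo the relations: the values of a
linear form on the words of length [d] are obtained by integrating the
prescribed differences between words that differ by one adjacent swap, and the
closed loops of swaps are generated by squares (disjoint swaps) and hexagons
(braid relation), which amount to invariance and to the Jacobi identity.

For the three-parameter family put [alpha = a - b].  The sum of all [e_i] is
central, so [b] and [c] only contribute a central factor, and the Jacobi element
is a polynomial in [alpha] whose coefficients are identities between sums of
products of two cycles of length 3 or 5.  The indices in such a sum either
coincide or are distinct; splitting accordingly, each identity becomes a finite
cancellation of coded terms on at most 7 points, checked by computation.

Conversely, the quadratic part of the Jacobi identity says that each coordinate
of [kappa^L_g] is an alternating form [beta] with
[sum_cyc beta(i,j) (e_l - g e_l) = 0].  Such a form, if nonzero and invariant
under the transpositions commuting with [g], forces [g] to be a 3-cycle, which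
leaves the parameters [a] and [b].  The linear part then determines [kappa^C] up
to a form of the same kind, which leaves [c]. *)

(** * Potentials on words with prescribed swap differences *)

Section Potential.
Variables (K : fieldType) (n : nat).
Implicit Types (i j x y : 'I_n) (p q r s u v w : seq 'I_n).

Definition ileq (i j : 'I_n) : bool := (i <= j)%N.

Fixpoint insr x s :=
  if s is y :: s' then if (x <= y)%N then x :: s else y :: insr x s' else [:: x].

Fixpoint isort w := if w is x :: w' then insr x (isort w') else [::].

Lemma perm_insr x s : perm_eq (insr x s) (x :: s).
Proof.
elim: s => //= y s IH; case: ifP => // _.
by rewrite -(perm_cons y) in IH; apply: perm_trans IH _; exact: (permEl (perm_catCA [:: y] [:: x] s)).
Qed.

Lemma sorted_insr x s : sorted ileq s -> sorted ileq (insr x s).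
Proof.
case: s => //= y s; case: ifP => [xy ys|]; first by rewrite /= /ileq xy.
move/negbT; rewrite -ltnNge => /ltnW yx.
elim: s y yx => [|z s IH] y yx /=; first by rewrite /ileq yx.
case/andP=> yz zs; case: ifP => xz /=; first by rewrite /ileq yx xz.
rewrite yz; apply: IH => //.
by move/negbT: xz; rewrite -ltnNge => /ltnW.
Qed.

Lemma sorted_isort w : sorted ileq (isort w).
Proof. by elim: w => //= x w IH; apply: sorted_insr. Qed.

Lemma perm_isort w : perm_eq (isort w) w.
Proof.
elim: w => //= x w IH; apply: perm_trans (perm_insr _ _) _.
by rewrite perm_cons.
Qed.

Lemma sorted_ileq_eq s1 s2 :
  sorted ileq s1 -> sorted ileq s2 -> perm_eq s1 s2 -> s1 = s2.
Proof.
apply: sorted_eq; first by move=> ? ? ?; apply: leq_trans.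
by move=> a b /anti_leq /val_inj.
Qed.

Lemma isort_perm w1 w2 : perm_eq w1 w2 -> isort w1 = isort w2.
Proof.
move=> E; apply: sorted_ileq_eq; rewrite ?sorted_isort //.
apply: perm_trans (perm_isort _) _; apply: perm_trans E _.
by rewrite perm_sym perm_isort.
Qed.

Lemma isort_id w : sorted ileq w -> isort w = w.
Proof.
by move=> E; apply: sorted_ileq_eq; rewrite ?sorted_isort ?perm_isort.
Qed.

Lemma size_isort w : size (isort w) = size w.
Proof. exact: perm_size (perm_isort w). Qed.

(* [D u i j v] is the prescribed difference between the values at
   [u ++ i :: j :: v] and at [u ++ j :: i :: v]; the square and hexagon
   identities make these differences integrable to a potential on words. *)
Variable D : seq 'I_n -> 'I_n -> 'I_n -> seq 'I_n -> K.

(** Sums of [D] along the swaps of insertion sort: [ins] carries [x] to its place in a sorted list,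
    and [cost] sorts the tail before inserting the head. The prefix [p] records the letters standing
    to the left; equal letters are never swapped. *)
Fixpoint ins p x s :=
  if s is y :: s' then
    if (x <= y)%N then 0 else D p x y s' + ins (rcons p y) x s'
  else 0.

Fixpoint cost p w :=
  if w is x :: w' then cost (rcons p x) w' + ins p x (isort w') else 0.

Lemma ins_sorted p x s : sorted ileq (x :: s) -> ins p x s = 0.
Proof. by case: s => //= y s /andP[]; rewrite /ileq => ->. Qed.

Lemma cost_sorted p w : sorted ileq w -> cost p w = 0.
Proof.
elim: w p => //= x w IH p xw.
have sw : sorted ileq w by apply: path_sorted xw.
by rewrite IH // isort_id // ins_sorted // addr0.
Qed.

Lemma cost_eq0 p w : (forall u i j v, D u i j v = 0) -> cost p w = 0.
Proof.
move=> D0; elim: w p => //= x w IH p; rewrite IH add0r.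
elim: (isort w) p => //= y s IHs p.
by case: ifP => // _; rewrite D0 IHs addr0.
Qed.

Hypothesis Danti : forall u i j v, D u i j v = - D u j i v.
Hypothesis Ddiag : forall u i v, D u i i v = 0.
Hypothesis Dsquare : forall p i j q x y r,
  D (p ++ i :: j :: q) x y r - D (p ++ j :: i :: q) x y r =
  D p i j (q ++ x :: y :: r) - D p i j (q ++ y :: x :: r).
Hypothesis Dhex : forall p i j y r,
  D (rcons p i) j y r + D p i y (j :: r) + D (rcons p y) i j r =
  D (rcons p j) i y r + D p j y (i :: r) + D p i j (y :: r).

(** Every swap that moves [x] through [s] happens to the right of [i] and [j], so [Dsquare] applies
    to each and the sum telescopes. *)
Lemma ins_square p i j q x s :
  ins (p ++ i :: j :: q) x s - ins (p ++ j :: i :: q) x s =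
  D p i j (q ++ x :: s) - D p i j (q ++ insr x s).
Proof.
elim: s q => [|y s IH] q /=; first by rewrite !subrr.
case: ifP => _ /=; first by rewrite !subrr.
rewrite !rcons_cat /= opprD addrACA Dsquare IH -!cats1 -!catA /=.
by rewrite addrA subrK.
Qed.

Lemma cost_square p i j q v :
  cost (p ++ i :: j :: q) v - cost (p ++ j :: i :: q) v =
  D p i j (q ++ v) - D p i j (q ++ isort v).
Proof.
elim: v q => [|x v IH] q /=; first by rewrite !subrr.
rewrite opprD addrACA !rcons_cat /= IH ins_square -!cats1 -!catA /=.
by rewrite addrA subrK.
Qed.

(** The two orders of inserting [i] and [j] form a loop with their swap. If both pass the head [y],
    the loop is filled by the loop behind [y], two strips of squares and one hexagon at [y];
    otherwise [i] stops before [y] and the terms cancel directly. *)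
Lemma ins_swap p i j s : (i < j)%N -> sorted ileq s ->
  ins (rcons p i) j s + ins p i (insr j s)
  - (ins (rcons p j) i s + ins p j (insr i s)) = D p i j s.
Proof.
move=> ij; have ijF : (j <= i)%N = false by rewrite leqNgt ij.
elim: s p => [|y s IH] p ss /=.
  by rewrite (ltnW ij) ijF /= !add0r addr0 ?sub0r (Danti p i j).
have sss : sorted ileq s by apply: path_sorted ss.
case: (leqP j y) => jy /=.
  have iy : (i <= y)%N by apply: leq_trans jy; apply: ltnW.
  rewrite iy (ltnW ij) /= ijF jy !addr0 add0r ?sub0r.
  by rewrite ?add0r (Danti p i j).
case: (leqP i y) => iy /=.
  rewrite ijF leqNgt jy /= add0r addr0 (Danti p i j).
  by rewrite [D p j i _ + _]addrC opprD addrA subrr sub0r.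
rewrite ?(leqNgt i) ?(leqNgt j) ?iy ?jy /=.
have H1 := IH (rcons p y) sss.
have H2 := ins_square p i y [::] j s.
rewrite /= -[p ++ i :: y :: [::]]/(p ++ [:: i] ++ [:: y]) in H2.
rewrite -[p ++ y :: i :: [::]]/(p ++ [:: y] ++ [:: i]) in H2.
rewrite !catA !cats1 in H2.
have H3 := ins_square p j y [::] i s.
rewrite /= -[p ++ j :: y :: [::]]/(p ++ [:: j] ++ [:: y]) in H3.
rewrite -[p ++ y :: j :: [::]]/(p ++ [:: y] ++ [:: j]) in H3.
rewrite !catA !cats1 in H3.
have H4 := Dhex p i j y s.
move: H1 H2 H3 H4.
set a1 := ins _ _ _; set a2 := ins _ _ _; set a3 := ins _ _ _.
set a4 := ins _ _ _; set a5 := D _ _ _ _.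
set b1 := ins _ _ _; set b2 := D _ _ _ _; set b3 := D _ _ _ _.
set c1 := ins _ _ _; set c2 := D _ _ _ _; set c3 := D _ _ _ _.
set d1 := D _ _ _ _; set d2 := D _ _ _ _; set d3 := D _ _ _ _.
move=> H1 H2 H3 H4.
apply/eqP; rewrite -subr_eq0; apply/eqP.
transitivity ((a1 + a2 - (a3 + a4) - a5) + (b1 - a1 - (b2 - b3))
  - (c1 - a3 - (c2 - c3)) + (d1 + b2 + a5 - (d2 + c2 + d3))); last first.
  by rewrite H1 H2 H3 H4 !subrr subr0 !addr0.
by ring.
Qed.

Variable base : seq 'I_n -> K.
Definition potential w := base (isort w) + cost [::] w.

(** [ins_swap] handles a sorted tail, and [cost_square] transports the swap from the sorted tail
    back to [v]. *)
Lemma cost_head p i j v :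
  cost p (i :: j :: v) - cost p (j :: i :: v) = D p i j v.
Proof.
wlog ij : i j / (i < j)%N.
  move=> H; case: (ltngtP i j) => [/H //|/H E|/val_inj ->].
    by rewrite Danti -E opprB.
  by rewrite Ddiag subrr.
rewrite /=; have H1 := cost_square p i j [::] v.
rewrite /= -[p ++ i :: j :: [::]]/(p ++ [:: i] ++ [:: j]) in H1.
rewrite -[p ++ j :: i :: [::]]/(p ++ [:: j] ++ [:: i]) in H1.
rewrite !catA !cats1 in H1.
have H2 := ins_swap p ij (sorted_isort v).
rewrite -[RHS](subrK (D p i j (isort v))) -H1 -H2.
by ring.
Qed.

Lemma cost_swap p u i j v :
  cost p (u ++ i :: j :: v) - cost p (u ++ j :: i :: v) = D (p ++ u) i j v.
Proof.
elim: u p => [|x u IH] p; first by rewrite cats0 cost_head.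
have E : isort (u ++ i :: j :: v) = isort (u ++ j :: i :: v).
  apply: isort_perm; rewrite perm_cat2l.
  exact: (permEl (perm_catCA [:: i] [:: j] v)).
by rewrite /= E opprD addrACA subrr addr0 IH -cats1 -catA.
Qed.

Lemma potential_swap u i j v :
  potential (u ++ i :: j :: v) - potential (u ++ j :: i :: v) = D u i j v.
Proof.
have E : isort (u ++ i :: j :: v) = isort (u ++ j :: i :: v).
  apply: isort_perm; rewrite perm_cat2l.
  exact: (permEl (perm_catCA [:: i] [:: j] v)).
by rewrite /potential E opprD addrACA subrr add0r cost_swap.
Qed.

Lemma potential_sorted w : sorted ileq w -> potential w = base w.
Proof. by move=> sw; rewrite /potential isort_id // cost_sorted // addr0. Qed.
End Potential.

(** * Linear forms on the tensor skew group algebra *)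

Section LinearForms.
Variables (K : fieldType) (n : nat).
Implicit Types (f : elt K n) (phi : seq 'I_n -> {perm 'I_n} -> K).

Definition lin phi f : K := \sum_(p <- f) p.1 * phi p.2.1 p.2.2.

Lemma lin_cat phi f g : lin phi (f ++ g) = lin phi f + lin phi g.
Proof. by rewrite /lin big_cat. Qed.

Lemma lin_scale phi a f : lin phi (scale a f) = a * lin phi f.
Proof. by rewrite /lin big_map mulr_sumr; apply: eq_bigr => p _ /=; rewrite mulrA. Qed.

Lemma lin_esub phi f g : lin phi (esub f g) = lin phi f - lin phi g.
Proof. by rewrite lin_cat lin_scale mulN1r. Qed.

Lemma lin_flatten (T : Type) phi (s : seq T) (F : T -> elt K n) :
  lin phi (flatten [seq F x | x <- s]) = \sum_(x <- s) lin phi (F x).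
Proof.
elim: s => [|x s IH] /=; first by rewrite /lin !big_nil.
by rewrite lin_cat IH big_cons.
Qed.

Lemma linE phi f :
  lin phi f = \sum_(m <- undup (map snd f)) coef f m * phi m.1 m.2.
Proof.
under [RHS]eq_bigr => m _ do rewrite /coef mulr_suml big_mkcond.
rewrite exchange_big /=; apply: eq_big_seq => p pf.
have up : p.2 \in undup (map snd f) by rewrite mem_undup map_f.
rewrite (bigD1_seq p.2) ?undup_uniq //= eqxx big1 ?addr0 // => m.
by rewrite eq_sym => /negbTE->.
Qed.

Lemma coef0 f m : m \notin map snd f -> coef f m = 0.
Proof.
move=> mf; rewrite /coef big_seq_cond big1 // => p /andP[pf /eqP E].
by rewrite -E map_f in mf.
Qed.

(** Elements are unreduced lists of terms, compared by coefficients; this makes [lin phi] well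
    defined on them. *)
Lemma lin_coef phi f g : (forall m, coef f m = coef g m) -> lin phi f = lin phi g.
Proof.
move=> E; pose r := undup (map snd f ++ map snd g).
suff H f' : {subset map snd f' <= r} -> (forall m, coef f' m = coef f m) ->
    lin phi f' = \sum_(m <- r) coef f m * phi m.1 m.2.
  rewrite !H // => m; rewrite /r mem_undup mem_cat; first by move=> ->; rewrite orbT.
  by move=> ->.
move=> sub Ef; rewrite linE.
under eq_bigr do rewrite Ef.
rewrite [RHS](bigID (mem (map snd f'))) /= [X in _ = _ + X]big1 ?addr0 => [|m mf]; last first.
  by rewrite -Ef coef0 ?mul0r.
rewrite -[RHS]big_filter; apply: perm_big; apply: uniq_perm.
- exact: undup_uniq.
- by rewrite filter_uniq ?undup_uniq.
move=> m; rewrite mem_filter mem_undup /=.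
by case: (boolP (m \in map _ f')) => // /sub ->.
Qed.

(** Coefficients are themselves linear forms, so identities about [coef] follow from those about
    [lin]. *)
Definition dirac (m0 : mon n) (w : seq 'I_n) (g : {perm 'I_n}) : K :=
  ((w, g) == m0)%:R.

Lemma coef_dirac f m : coef f m = lin (dirac m) f.
Proof.
rewrite /coef /lin big_mkcond; apply: eq_bigr => -[a [w g]] _.
by rewrite /dirac /=; case: eqP; rewrite ?mulr1 ?mulr0.
Qed.

Lemma lin_mul1l phi m f :
  lin phi (emul [:: (1, m)] f) =
  lin (fun w g => phi (m.1 ++ map m.2 w) (g * m.2)%g) f.
Proof.
by rewrite /emul /= cats0 /lin big_map; apply: eq_bigr => p _ /=; rewrite mul1r.
Qed.

Lemma lin_mul1r phi m f :
  lin phi (emul f [:: (1, m)]) =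
  lin (fun w g => phi (w ++ map g m.1) (m.2 * g)%g) f.
Proof.
rewrite /lin /emul; elim: f => [|p f IH] /=; first by rewrite !big_nil.
by rewrite !big_cons IH /= mulr1.
Qed.

End LinearForms.

(** * From invariance and the Jacobi identity to the PBW property *)

Section Cochains.
Variables (K : fieldType) (n : nat).
Variables (kL : {perm 'I_n} -> 'I_n -> 'I_n -> 'I_n -> K)
          (kC : {perm 'I_n} -> 'I_n -> 'I_n -> K).
Implicit Types (F phi : seq 'I_n -> {perm 'I_n} -> K).

(* The value of [F] on kappa(e_i, e_j), read as an element of T(V)#G. *)
Definition kapply i j F : K :=
  \sum_(h : {perm 'I_n})
    ((\sum_(l : 'I_n) kL h i j l * F [:: l] h) + kC h i j * F [::] h).

Lemma eq_kapply i j F F' : (forall w h, (size w <= 1)%N -> F w h = F' w h) ->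
  kapply i j F = kapply i j F'.
Proof.
move=> E; apply: eq_bigr => h _; rewrite E //; congr (_ + _).
by apply: eq_bigr => l _; rewrite E.
Qed.

Lemma kapply0 i j : kapply i j (fun _ _ => 0) = 0.
Proof.
rewrite /kapply big1 // => h _; rewrite mulr0 addr0 big1 // => l _.
by rewrite mulr0.
Qed.

Lemma kapplyD i j F F' :
  kapply i j (fun w h => F w h + F' w h) = kapply i j F + kapply i j F'.
Proof.
rewrite -big_split; apply: eq_bigr => h _ /=.
rewrite mulrDr addrACA -big_split /=; congr (_ + _).
by apply: eq_bigr => l _; rewrite mulrDr.
Qed.

Lemma kapplyZ i j a F : kapply i j (fun w h => a * F w h) = a * kapply i j F.
Proof.
rewrite mulr_sumr; apply: eq_bigr => h _ /=.
rewrite mulrDr mulr_sumr mulrCA; congr (_ + _).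
by apply: eq_bigr => l _; rewrite mulrCA.
Qed.

Lemma kapplyB i j F F' :
  kapply i j (fun w h => F w h - F' w h) = kapply i j F - kapply i j F'.
Proof.
rewrite -mulN1r -kapplyZ -kapplyD; apply: eq_kapply => w h _.
by rewrite mulN1r.
Qed.

Lemma kapply_sum (T : Type) (r : seq T) (P : pred T) i j
    (F : T -> seq 'I_n -> {perm 'I_n} -> K) :
  kapply i j (fun w h => \sum_(x <- r | P x) F x w h) =
  \sum_(x <- r | P x) kapply i j (F x).
Proof.
elim: r => [|x r IH].
  rewrite big_nil -[RHS](kapply0 i j).
  by apply: eq_kapply => w h _; rewrite big_nil.
rewrite big_cons -IH; case Px: (P x); last first.
  by apply: eq_kapply => w h _; rewrite big_cons Px.
by rewrite -kapplyD; apply: eq_kapply => w h _; rewrite big_cons Px.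
Qed.

Lemma kapply_exchange i j x y (G : seq 'I_n -> {perm 'I_n} -> seq 'I_n -> {perm 'I_n} -> K) :
  kapply x y (fun w h => kapply i j (G w h)) =
  kapply i j (fun w' h' => kapply x y (fun w h => G w h w' h')).
Proof.
rewrite {1}/kapply [RHS]kapply_sum; apply: eq_bigr => h _.
by rewrite kapplyD kapply_sum kapplyZ; under [in RHS]eq_bigr do rewrite kapplyZ.
Qed.

Lemma lin_rel i j phi :
  lin phi (Defs.rel kL kC i j) =
  phi [:: i; j] 1%g - phi [:: j; i] 1%g - kapply i j phi.
Proof.
rewrite /Defs.rel !lin_cat {1}/lin big_cons big_seq1 /= mul1r mulN1r.
congr (_ + _).
rewrite /kapply big_split /= opprD; congr (_ + _).
- rewrite /lin big_allpairs_dep /= big_enum /= -sumrN.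
  apply: eq_bigr => h _; rewrite big_enum /= -sumrN.
  by apply: eq_bigr => l _; rewrite mulNr.
- rewrite /lin big_map big_enum /= -sumrN.
  by apply: eq_bigr => h _; rewrite mulNr.
Qed.

Definition relmon (m1 : mon n) (i j : 'I_n) (m2 : mon n) : elt K n :=
  emul [:: (1, m1)] (emul (Defs.rel kL kC i j) [:: (1, m2)]).

Lemma lin_relmon phi m1 i j m2 :
  lin phi (relmon m1 i j m2) =
  let F w (h : {perm 'I_n}) := phi (m1.1 ++ map m1.2 (w ++ map h m2.1)) (m2.2 * h * m1.2)%g in
  F [:: i; j] 1%g - F [:: j; i] 1%g - kapply i j F.
Proof. by rewrite /relmon lin_mul1l lin_mul1r lin_rel. Qed.

Definition invariantL := forall s g i j l,
  kL (g ^ s)%g (s i) (s j) (s l) = kL g i j l.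
Definition invariantC := forall s g i j,
  kC (g ^ s)%g (s i) (s j) = kC g i j.

(* [phi] vanishes on the relations [vw - wv - kappa(v,w)], multiplied by
   arbitrary words and group elements, as long as the length stays <= d. *)
Definition respects (d : nat) phi := forall u i j v g,
  ((size u + size v).+2 <= d)%N ->
  phi (u ++ i :: j :: v) g - phi (u ++ j :: i :: v) g =
  kapply i j (fun w h => phi (u ++ w ++ map h v) (g * h)%g).

(** Dual formulation: the cyclic sum of the commutators of kappa(e_i, e_j) with e_l vanishes modulo
    the relations of length at most 2, tested by all forms that respect these. The letter [h l]
    appears because e_l has to cross the group element [h]. *)
Definition jacobi := forall phi, respects 2 phi -> forall i j l,
  let J i j l := kapply i j (fun w h => phi (rcons w (h l)) h - phi (l :: w) h) in
  J i j l + J j l i + J l i j = 0.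

Hypothesis (altL : alternatingL kL) (altC : alternatingC kC).
Hypothesis (invL : invariantL) (invC : invariantC).

Lemma kapply_alt i j F : kapply i j F = - kapply j i F.
Proof.
rewrite -sumrN; apply: eq_bigr => h _.
rewrite opprD -sumrN (altC h j i).2 mulNr; congr (_ + _).
by apply: eq_bigr => l _; rewrite (altL h j i l).2 mulNr.
Qed.

Lemma kapply_diag i F : kapply i i F = 0.
Proof.
rewrite /kapply big1 // => h _; rewrite (altC h i i).1 mul0r addr0.
by rewrite big1 // => l _; rewrite (altL h i i l).1 mul0r.
Qed.

Lemma kapply_conj (s : {perm 'I_n}) i j F :
  kapply (s i) (s j) F = kapply i j (fun w h => F (map s w) (h ^ s)%g).
Proof.
rewrite /kapply (reindex_inj (conjg_inj s)) /=; apply: eq_bigr => h _.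
rewrite invC (reindex_inj (@perm_inj _ s)) /=; congr (_ + _).
by apply: eq_bigr => l _; rewrite invL.
Qed.

(** The group element of [m1] is moved through kappa by invariance, which reduces a general multiple
    of a relation to the case covered by [respects]. *)
Lemma respects_relmon d phi m1 i j m2 : respects d phi ->
  ((size m1.1 + size m2.1).+2 <= d)%N -> lin phi (relmon m1 i j m2) = 0.
Proof.
case: m1 m2 => u s [v g] Rphi sz; rewrite lin_relmon /=.
rewrite mulg1 !(eq_map (@perm1 _)) !map_id Rphi ?size_map //.
apply/eqP; rewrite subr_eq0 kapply_conj; apply/eqP/eq_kapply => w h _.
rewrite map_cat -!map_comp; congr (phi _ _).
  by congr (_ ++ (_ ++ _)); apply: eq_map => x /=; rewrite !permM permK.
by rewrite conjgE !mulgA mulgK.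
Qed.

(** Induction on the length bound. On words of length [d.+1] the form is the potential of the
    differences that kappa dictates from shorter words, with [dirac] on sorted words as initial
    values. Since kappa shortens words, the form stays zero below the length of [m0]. *)
Lemma exists_respects (m0 : mon n) d : jacobi -> exists phi, [/\ respects d phi,
  forall w g, sorted (@ileq n) w -> phi w g = dirac K m0 w g &
  forall w g, (size w < size m0.1)%N -> phi w g = 0].
Proof.
move=> jac; elim: d => [|d [phi [Rphi Sphi Zphi]]].
  exists (dirac K m0); split=> // w g sz; rewrite /dirac.
  by case: eqP => // E; rewrite -E ltnn in sz.
(* The length test makes [D] zero for all other lengths, so that the square and hexagon identities
   hold without restriction on the words. *)
pose D g u i j v := if (size u + size v).+2 == d.+1 then
  kapply i j (fun w h => phi (u ++ w ++ map h v) (g * h)%g) else 0.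
pose phi' w g := if size w == d.+1 then
  potential (D g) (fun w => dirac K m0 w g) w else phi w g.
exists phi'; split; last first.
- move=> w g sz; rewrite /phi'; case: eqP => [E|_]; last exact: Zphi.
  rewrite /potential cost_eq0 => [|u i j v].
    rewrite addr0 /dirac; case: eqP => // E'.
    by rewrite -E' /= size_isort ltnn in sz.
  rewrite /D; case: eqP => // E'; rewrite -[RHS](kapply0 i j).
  apply: eq_kapply => w' h sz'; apply: Zphi.
  apply: leq_trans sz; rewrite E -E' !size_cat size_map.
  by rewrite ltnS addnCA -add1n leq_add.
- move=> w g sw; rewrite /phi'; case: eqP => _; last exact: Sphi.
  by rewrite potential_sorted.
move=> u i j v g; rewrite leq_eqVlt => /orP[/eqP sz|]; last first.
  rewrite ltnS => sz; rewrite /phi' !size_cat /= !addnS.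
  rewrite ltn_eqF ?ltnS // Rphi //; apply: eq_kapply => w h szw.
  rewrite /phi' ltn_eqF // !size_cat size_map addnCA ltnS.
  by apply: leq_trans (leq_add szw (leqnn _)) _; rewrite add1n ltnW.
have szE w : (size w <= 1)%N -> forall h : {perm 'I_n}, size (u ++ w ++ map h v) == d.+1 = false.
  move=> szw h; rewrite ltn_eqF // !size_cat size_map addnCA -sz.
  by rewrite ltnS; apply: leq_trans (leq_add szw (leqnn _)) _.
rewrite /phi' !size_cat /= !addnS sz eqxx.
rewrite [RHS](_ : _ = D g u i j v); last first.
  by rewrite /D sz eqxx; apply: eq_kapply => w h szw; rewrite szE.
apply: potential_swap => {u i j v sz szE}.
- by move=> u i j v; rewrite /D; case: eqP => _; rewrite ?oppr0 // kapply_alt.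
- by move=> u i v; rewrite /D kapply_diag; case: ifP.
(* Square: [Rphi] turns both sides into kappa applied at two disjoint places. The two orders agree
   by [kapply_exchange], once [kapply_conj] has accounted for the group element acting on [x] and
   [y]. *)
- move=> p i j q x y r; rewrite /D.
  have [e1 e2 e3] : [/\ size (p ++ j :: i :: q) = size (p ++ i :: j :: q),
      (size p + size (q ++ x :: y :: r) = size (p ++ i :: j :: q) + size r)%N &
      (size p + size (q ++ y :: x :: r) = size (p ++ i :: j :: q) + size r)%N].
    by rewrite !size_cat /=; split; lia.
  rewrite e1 e2 e3; case: eqP => [sz|]; last by rewrite !subrr.
  rewrite -!kapplyB.
  transitivity (kapply x y (fun w h => kapply i j (fun w' h' =>
      phi (p ++ w' ++ map h' (q ++ w ++ map h r)) (g * h * h')%g))).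
    apply: eq_kapply => w h szw; rewrite -!catA /= Rphi //.
    by move: sz; rewrite !size_cat /= size_map; lia.
  rewrite kapply_exchange; apply: eq_kapply => w' h' szw'.
  rewrite !map_cat /= !(catA w') !(catA p) Rphi; last first.
    by move: sz; rewrite !size_cat /= !size_map; lia.
  rewrite kapply_conj; apply: eq_kapply => w h _.
  rewrite !map_cat -!catA -!map_comp conjgE !mulgA mulgK.
  congr (phi (_ ++ (_ ++ (_ ++ (_ ++ _)))) _).
  by apply: eq_map => z /=; rewrite !permM permK.
(* Hexagon: [Phi] is [phi] with the outer letters [p] and [r] frozen. It respects the relations in
   length 2, so the Jacobi identity applies to it. *)
- move=> p i j y r; rewrite /D !size_rcons /= !addSn !addnS.
  case: eqP => [sz|]; last by rewrite !addr0.
  pose Phi w (h : {perm 'I_n}) := phi (p ++ w ++ map h r) (g * h)%g.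
  have RPhi : respects 2 Phi.
    move=> u i' j' v h; rewrite !ltnS leqn0 addn_eq0 !size_eq0.
    case/andP=> /eqP-> /eqP->; rewrite /Phi /= Rphi; last by rewrite size_map; case: sz => ->.
    apply: eq_kapply => w h' _; rewrite cats0 mulgA -map_comp.
    congr (phi (_ ++ (_ ++ _)) _).
    by apply: eq_map => x; rewrite /= permM.
  have := jac _ RPhi i j y; rewrite /= !kapplyB.
  rewrite (kapply_alt y i) (kapply_alt y i).
  have E1 a b c : kapply a b (fun w h => Phi (rcons w (h c)) h) =
      kapply a b (fun w h => phi (p ++ w ++ map h (c :: r)) (g * h)%g).
    by apply: eq_kapply => w h _; rewrite /Phi -cats1 -catA.
  have E2 a b c : kapply a b (fun w h => Phi (c :: w) h) =
      kapply a b (fun w h => phi (rcons p c ++ w ++ map h r) (g * h)%g).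
    by apply: eq_kapply => w h _; rewrite /Phi cat_rcons.
  rewrite !E1 !E2.
  set a1 := kapply _ _ _; set a2 := kapply _ _ _; set a3 := kapply _ _ _.
  set a4 := kapply _ _ _; set a5 := kapply _ _ _; set a6 := kapply _ _ _.
  move=> H; apply/eqP; rewrite -subr_eq0 -oppr_eq0; apply/eqP.
  rewrite -[RHS]H; by ring.
Qed.

(** A nonzero coefficient of [f] at [m0] is detected by the form of [exists_respects]: it takes that
    coefficient as value on [f], vanishes on [f'] for reasons of degree, and vanishes on the given
    element of the ideal. *)
Theorem jacobi_DOA : jacobi -> DOA kL kC.
Proof.
move=> jac d f Of [f' [Df' If']] m0; apply/eqP/negPn/negP => fm0.
have [sm0 dm0] := Of _ fm0.
have [s Es] := If'.
(* Greatest length of a word in the certificate of membership in the ideal, the two letters of the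
   relation included; the form is built up to this length. *)
pose N := (\max_(x <- s) (size x.1.2.1 + size x.2.2.1).+2)%N.
have [phi [Rphi Sphi Zphi]] := exists_respects m0 N jac.
have Z x : x \in s -> lin phi (relmon x.1.2 x.2.1.1 x.2.1.2 x.2.2) = 0.
  move=> xs; apply: (respects_relmon _ _ Rphi).
  by rewrite /N (big_rem x xs) /= leq_max leqnn.
have := lin_coef phi Es; rewrite lin_flatten lin_esub.
rewrite [RHS]big_seq big1 => [|x xs]; last first.
  by rewrite lin_scale [lin _ _](Z x xs) mulr0.
rewrite [lin phi f']linE [X in _ - X]big1_seq ?subr0 => [|m /andP[_ _]]; last first.
  case: (leqP d (size m.1)) => sz; first by rewrite Df' // mul0r.
  by rewrite Zphi ?mulr0 // dm0.
have -> : lin phi f = lin (dirac K m0) f.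
  rewrite !linE; apply: eq_bigr => m _.
  have [->|/Of[sm _]] := eqVneq (coef f m) 0; first by rewrite !mul0r.
  by rewrite Sphi.
by rewrite -coef_dirac => E; rewrite E eqxx in fm0.
Qed.
End Cochains.

(** * Cycles given by lists *)

Section Cycles.
Variable T : finType.
Implicit Types (s : seq T) (x : T).

(** Total, with the identity as default on lists with repetitions, so that coded cycles carry no
    proofs. *)
Definition cyc s : {perm T} :=
  if @idP (uniq s) is ReflectT U then perm (can_inj (prev_next U)) else 1%g.

Lemma cycE s : uniq s -> cyc s =1 next s.
Proof.
by move=> U x; rewrite /cyc; case: {-}_ / idP => [U'|/(_ U)//]; rewrite permE.
Qed.

Lemma cyc0 : cyc [::] = 1%g.
Proof. by apply/permP => x; rewrite cycE // perm1. Qed.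

Lemma cyc_out s x : uniq s -> x \notin s -> cyc s x = x.
Proof. by move=> U xs; rewrite cycE // next_nth (negbTE xs). Qed.

Lemma cycV s : uniq s -> (cyc s)^-1%g = cyc (rev s).
Proof.
move=> U; apply/permP => x; apply: (@perm_inj _ (cyc s)).
by rewrite permKV (cycE U) cycE ?rev_uniq // next_rev // next_prev.
Qed.

Lemma cyc_conj s (t : {perm T}) : uniq s -> (cyc s ^ t)%g = cyc (map t s).
Proof.
move=> U; have Ut : uniq (map t s) by rewrite map_inj_uniq //; apply: perm_inj.
apply/permP => x; rewrite -[x](permKV t) permJ !cycE //.
by rewrite next_map //; apply: perm_inj.
Qed.
End Cycles.

(** * Sums over distinct points and their coincidence patterns *)

Section DistinctSums.
Variables (K : fieldType) (T : finType).
Implicit Types (b s : seq T) (F G : seq T -> K).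

Fixpoint dsum m b F : K :=
  if m is m'.+1 then \sum_(x | x \notin b) dsum m' (rcons b x) F else F b.

Lemma dsumS m b F : dsum m.+1 b F = \sum_(x | x \notin b) dsum m (rcons b x) F.
Proof. by []. Qed.

Lemma eq_dsum m b F G : uniq b ->
  (forall s, uniq s -> size s = (size b + m)%N -> take (size b) s = b -> F s = G s) ->
  dsum m b F = dsum m b G.
Proof.
elim: m b => [|m IH] b Ub E /=; first by apply: E; rewrite ?addn0 ?take_size.
apply: eq_bigr => x xb; apply: IH; first by rewrite rcons_uniq xb.
move=> s Us sz Et; apply: E; rewrite // ?sz ?size_rcons ?addnS //.
have := congr1 (take (size b)) Et; rewrite size_rcons take_takel //.
by rewrite -cats1 take_size_cat.
Qed.

Lemma dsum_sum (A : Type) (r : seq A) m b (F : A -> seq T -> K) :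
  dsum m b (fun s => \sum_(a <- r) F a s) = \sum_(a <- r) dsum m b (F a).
Proof.
elim: m b => [|m IH] b //=; rewrite exchange_big /=.
by apply: eq_bigr => x _; rewrite IH.
Qed.

Lemma dsumZ m b a F : dsum m b (fun s => a * F s) = a * dsum m b F.
Proof.
elim: m b => [|m IH] b //=; rewrite mulr_sumr.
by apply: eq_bigr => x _; rewrite IH.
Qed.

Lemma dsumD m b F G : dsum m b (fun s => F s + G s) = dsum m b F + dsum m b G.
Proof.
elim: m b => [|m IH] b //=; rewrite -big_split.
by apply: eq_bigr => x _; rewrite IH.
Qed.

Lemma dsum0 m b : dsum m b (fun=> 0) = 0.
Proof. by elim: m b => //= m IH b; rewrite big1 // => x _; rewrite IH. Qed.

Lemma dsum_tuple m b F : uniq b ->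
  dsum m b F = \sum_(t : m.-tuple T | uniq (b ++ t)) F (b ++ t).
Proof.
elim: m b => [|m IH] b Ub /=.
  rewrite (big_pred1 [tuple]) ?cats0 // => t.
  by rewrite tuple0 /= cats0 Ub eqxx.
rewrite [RHS](reindex (fun p : T * m.-tuple T => [tuple of p.1 :: p.2])) /=; last first.
  exists (fun t => (thead t, [tuple of behead t])) => [[x t] _|t _] /=.
    by congr (_, _); apply: val_inj.
  by rewrite [t in RHS]tuple_eta.
rewrite (eq_bigr (fun x => \sum_(t : m.-tuple T | uniq (b ++ x :: t)) F (b ++ x :: t))).
  rewrite (eq_bigl (fun p : T * m.-tuple T => (p.1 \notin b) && uniq (b ++ p.1 :: p.2))).
    by rewrite -(pair_big_dep (fun x => x \notin b)
      (fun x (t : m.-tuple T) => uniq (b ++ x :: t))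
      (fun x (t : m.-tuple T) => F (b ++ x :: t))).
  case=> x t /=; case: (boolP (x \in b)) => //= xb; apply: negbTE.
  by rewrite cat_uniq /= xb /= andbF.
move=> x xb; rewrite IH ?rcons_uniq ?xb //.
by apply: eq_big => [t|t _]; rewrite cat_rcons.
Qed.

Variable x0 : T.
Definition at_ s (c : seq nat) := map (nth x0 s) c.

Lemma at_comp s p c : all (fun a => a < size p)%N c ->
  at_ (at_ s p) c = at_ s (map (nth 0%N p) c).
Proof.
move=> /allP H; rewrite /at_ -map_comp; apply/eq_in_map => a /H sz /=.
by rewrite (nth_map 0%N).
Qed.

Definition goodperm N0 m (p : seq nat) :=
  [&& size p == (N0 + m)%N, take N0 p == iota 0 N0 & perm_eq (drop N0 p) (iota N0 m)].

(** The renaming keeps the points of [b] and permutes the new ones, so it is a bijection of the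
    range of summation. *)
Lemma dsum_relabel m b F p : uniq b -> goodperm (size b) m p ->
  dsum m b F = dsum m b (fun s => F (at_ s p)).
Proof.
move=> Ub /and3P[/eqP sp /eqP tp dp]; rewrite !dsum_tuple //.
have szc : size (drop (size b) p) == m by rewrite size_drop sp addKn.
have E (t : m.-tuple T) : at_ (b ++ t) p = b ++ at_ (b ++ t) (drop (size b) p).
  rewrite -{1}(cat_take_drop (size b) p) /at_ map_cat; congr (_ ++ _).
  rewrite tp; apply: (@eq_from_nth _ x0); rewrite size_map size_iota // => i ib.
  by rewrite (nth_map 0%N) ?size_iota // nth_iota // add0n nth_cat ib.
have szh (t : m.-tuple T) : size (at_ (b ++ t) (drop (size b) p)) == m.
  by rewrite size_map.
pose h t := Tuple (szh t).
have hinj : injective h.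
  move=> t t' /(congr1 val) /= eqh; apply: eq_from_tnth => i.
  rewrite !(tnth_nth x0).
  have bi : (size b + i)%N \in drop (size b) p.
    by rewrite (perm_mem dp) mem_iota leq_addr ltn_add2l ltn_ord.
  have := congr1 (fun s => nth x0 s (index (size b + i)%N (drop (size b) p))) eqh.
  rewrite /= !(nth_map 0%N) ?index_mem // nth_index // !nth_cat.
  by rewrite ltnNge leq_addr /= addKn.
rewrite (reindex_inj hinj) /=; apply: eq_big => [t|t _]; last by rewrite E.
apply: perm_uniq; rewrite perm_cat2l.
have Et : at_ (b ++ t) (iota (size b) m) = t.
  apply: (@eq_from_nth _ x0) => [|i]; rewrite size_tuple ?size_map ?size_iota // => im.
  by rewrite (nth_map 0%N) ?size_iota // nth_iota // nth_cat ltnNge leq_addr /= addKn.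
by have := perm_map (nth x0 (b ++ t)) dp; rewrite -!/(at_ _ _) Et.
Qed.

(** Coincidence patterns of [r] successive indices with [N] named points, positions in [A] being
    excluded. In a result, the first component counts the new points, and the second lists the
    positions of [A] followed by those of the indices. *)
Fixpoint choices r N (A : seq nat) : seq (nat * seq nat) :=
  if r is r'.+1 then
    flatten [seq choices r' N (rcons A a) | a <- [seq a <- iota 0 N | a \notin A]]
    ++ [seq (c.1.+1, c.2) | c <- choices r' N.+1 (rcons A N)]
  else [:: (0%N, A)].

Lemma mem_at b A a : uniq b -> all (fun a => a < size b)%N A -> (a < size b)%N ->
  (nth x0 b a \in at_ b A) = (a \in A).
Proof.
move=> Ub /allP HA ab; apply/mapP/idP => [[a' aA]|aA]; last by exists a.
by move/eqP; rewrite nth_uniq ?(HA a' aA) // => /eqP->.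
Qed.

Lemma mem_at_sub b A x : all (fun a => a < size b)%N A -> x \in at_ b A -> x \in b.
Proof. by move=> /allP HA /mapP[a aA ->]; rewrite mem_nth ?HA. Qed.

(* Each summation index either hits one of the points of [b] or is new. *)
Lemma dsum_choices r b A F : uniq b -> all (fun a => a < size b)%N A ->
  dsum r (at_ b A) F =
  \sum_(c <- choices r (size b) A) dsum c.1 b (fun s => F (at_ s c.2)).
Proof.
elim: r b A => [|r IH] b A Ub HA /=; first by rewrite big_seq1.
rewrite big_cat (bigID (mem b)) /=; congr (_ + _).
  rewrite big_flatten big_map big_filter.
  rewrite (eq_bigl (fun x => (x \in b) && (x \notin at_ b A))); last by move=> x; rewrite andbC.
  rewrite big_mkcondr -big_uniq //= (big_nth x0) [RHS]big_mkcond /index_iota subn0.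
  apply: eq_big_seq => a; rewrite mem_iota /= add0n => ab.
  rewrite mem_at //; case: (a \in A) => //=.
  rewrite -IH //; last by rewrite all_rcons ab.
  by rewrite /at_ map_rcons.
rewrite (eq_bigl (fun x => x \notin b)); last first.
  move=> x; case: (boolP (x \in b)) => xb; rewrite ?andbF ?andbT //.
  by apply: contra xb; apply: mem_at_sub.
rewrite big_map /= exchange_big /=; apply: eq_bigr => x xb.
have Ux : uniq (rcons b x) by rewrite rcons_uniq xb.
have HA' : all (fun a => a < size (rcons b x))%N (rcons A (size b)).
  rewrite all_rcons size_rcons leqnn /=; apply: sub_all HA => a.
  by move/ltnW.
rewrite -(size_rcons b x) -IH //; congr (dsum _ _ _).
rewrite /at_ map_rcons nth_rcons ltnn eqxx; congr (rcons _ _).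
by apply/eq_in_map => a /(allP HA) ab; rewrite nth_rcons ab.
Qed.
End DistinctSums.
Arguments dsum : simpl never.

(** * Coded terms and the computation of cancellations *)

(* [(k, (w, (c1, c2)))] codes [k] times the word [w] followed by the product of
   the cycles [c1] and [c2]; points are coded by their position in a list. *)
Definition term := (int * (seq nat * (seq nat * seq nat)))%type.

Definition codecycle N (c : seq nat) := uniq c && all (fun a => a < N)%N c.

Definition wf N (t : term) :=
  [&& all (fun a => a < N)%N t.2.1, codecycle N t.2.2.1 & codecycle N t.2.2.2].

(** A product of permutations applies its left factor first, hence the order of the two [next]. *)
Definition termimg N (t : term) :=
  [seq next t.2.2.2 (next t.2.2.1 a) | a <- iota 0 N].

Definition termkey N (t : term) := (t.2.1, termimg N t).

Definition relabel (p : seq nat) (t : term) : term :=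
  let f := map (nth 0%N p) in (t.1, (f t.2.1, (f t.2.2.1, f t.2.2.2))).

(* Numbering the points [>= N0] in the order in which they are met along the
   cycles gives equal codes to terms that differ by a renaming of these points. *)
Fixpoint visit fuel (img acc : seq nat) a :=
  if fuel is f.+1 then
    if a \in acc then acc else visit f img (rcons acc a) (nth 0%N img a)
  else acc.

Definition canon N0 N (t : term) : seq nat :=
  let img := termimg N t in
  let ex := [seq a <- foldl (visit N img) [::] (iota 0 N) | N0 <= a]%N in
  [seq if (a < N0)%N then a else (N0 + index a ex)%N | a <- iota 0 N].

(** Each round removes all entries with the key of the head, so the length of the list is enough
    fuel. *)
Fixpoint cancels (A : eqType) fuel (ks : seq (A * int)) :=
  match fuel, ks with
  | _, [::] => true
  | f.+1, (k, z) :: ks' =>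
      (foldr (fun p => +%R p.2) z [seq p <- ks' | p.1 == k] == 0)
      && cancels f [seq p <- ks' | p.1 != k]
  | 0%N, _ :: _ => false
  end.

Lemma cancels_sum (K : fieldType) (A : eqType) (v : A -> K) fuel ks :
  cancels fuel ks -> \sum_(p <- ks) p.2%:~R * v p.1 = 0.
Proof.
elim: fuel ks => [|f IH] [|[k z] ks] //=; rewrite ?big_nil //.
case/andP=> /eqP S /IH E; rewrite big_cons (bigID (fun p => p.1 == k)) /=.
rewrite -[X in _ + (_ + X)]big_filter E addr0.
rewrite (eq_bigr (fun p => p.2%:~R * v k)) => [|p /eqP-> //].
rewrite -big_filter -mulr_suml -mulrDl.
suff -> : z%:~R + \sum_(p <- [seq p <- ks | p.1 == k]) p.2%:~R = 0 :> K.
  by rewrite mul0r.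
rewrite -[RHS](rmorph0 (intmul 1)) -S; elim: filter => [|p r IHr] /=.
  by rewrite big_nil addr0.
by rewrite big_cons addrCA IHr rmorphD.
Qed.

Section Evaluation.
Variables (K : fieldType) (T : finType) (x0 : T).
Variable (Psi : seq T -> {perm T} -> K).
Implicit Types (s b : seq T) (t : term).

Definition ev s t : K := t.1%:~R *
  Psi (at_ x0 s t.2.1) (cyc (at_ x0 s t.2.2.1) * cyc (at_ x0 s t.2.2.2))%g.

Lemma at_uniq s c : uniq s -> codecycle (size s) c -> uniq (at_ x0 s c).
Proof.
move=> Us /andP[Uc /allP Hc]; rewrite map_inj_in_uniq // => a a' /Hc sa /Hc sa' /eqP.
by rewrite nth_uniq // => /eqP.
Qed.

Lemma cyc_at s c a : uniq s -> codecycle (size s) c -> (a < size s)%N ->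
  cyc (at_ x0 s c) (nth x0 s a) = nth x0 s (next c a).
Proof.
move=> Us wc sa; rewrite cycE ?at_uniq //.
have [Uc Hc] := andP wc.
rewrite !next_nth mem_at //; case: ifP => // ac.
case: c wc Uc Hc ac => // y c wc _ /allP Hc ac.
have -> : index (nth x0 s a) (at_ x0 s (y :: c)) = index a (y :: c).
  rewrite -{1}(nth_index 0%N ac) -(nth_map 0%N x0) ?index_mem //.
  rewrite index_uniq ?size_map ?index_mem //; exact: at_uniq Us wc.
rewrite -[LHS]/(nth (nth x0 s y) (map (nth x0 s) c) (index a (y :: c))).
have [lt|ge] := ltnP (index a (y :: c)) (size c); first by rewrite (nth_map y).
by rewrite [nth y c _]nth_default // nth_default // size_map.
Qed.

Lemma next_lt N c a : codecycle N c -> (a < N)%N -> (next c a < N)%N.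
Proof.
case/andP=> _ /allP Hc aN; case: (boolP (a \in c)) => ac.
  by apply: Hc; rewrite mem_next.
by rewrite next_nth (negbTE ac).
Qed.

(** Both cycles fix every point outside [s], so the table of images on positions determines their
    product. *)
Lemma ev_key s t t' : uniq s -> wf (size s) t -> wf (size s) t' ->
  termkey (size s) t = termkey (size s) t' ->
  Psi (at_ x0 s t.2.1) (cyc (at_ x0 s t.2.2.1) * cyc (at_ x0 s t.2.2.2))%g =
  Psi (at_ x0 s t'.2.1) (cyc (at_ x0 s t'.2.2.1) * cyc (at_ x0 s t'.2.2.2))%g.
Proof.
move=> Us /and3P[_ w1 w2] /and3P[_ w1' w2'] [-> E]; congr (Psi _ _).
apply/permP => x; rewrite !permM.
case: (boolP (x \in s)) => [/(nthP x0)[a sa <-]|xs].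
  rewrite !cyc_at ?next_lt //; congr (nth _ _ _).
  have := congr1 (fun r => nth 0%N r a) E.
  by rewrite !(nth_map 0%N) ?size_iota // !nth_iota // add0n.
have H c : codecycle (size s) c -> cyc (at_ x0 s c) x = x.
  move=> wc; rewrite cyc_out ?at_uniq //; apply: contra xs.
  by apply: mem_at_sub; case/andP: wc.
by rewrite !H.
Qed.

Lemma ev_relabel s p t : wf (size p) t ->
  ev (at_ x0 s p) t = ev s (relabel p t).
Proof.
case/and3P=> w0 /andP[_ w1] /andP[_ w2].
by rewrite /ev !at_comp.
Qed.

Lemma wf_relabel N p t : size p = N -> uniq p -> all (fun a => a < N)%N p ->
  wf N t -> wf N (relabel p t).
Proof.
move=> sp Up /allP Hp /and3P[w0 /andP[u1 w1] /andP[u2 w2]].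
have H c : all (fun a => a < N)%N c -> all (fun a => a < N)%N (map (nth 0%N p) c).
  move=> /allP Hc; apply/allP => _ /mapP[a ac ->].
  by apply: Hp; rewrite mem_nth // sp Hc.
have H' c : uniq c -> all (fun a => a < N)%N c -> uniq (map (nth 0%N p) c).
  move=> Uc /allP Hc; rewrite map_inj_in_uniq // => a a' /Hc sa /Hc sa' /eqP.
  by rewrite nth_uniq ?sp // => /eqP.
by rewrite /wf /codecycle /= !H ?H'.
Qed.

Lemma cancels_ev s (ts : seq term) : uniq s -> all (wf (size s)) ts ->
  cancels (size ts) [seq (termkey (size s) t, t.1) | t <- ts] ->
  \sum_(t <- ts) ev s t = 0.
Proof.
move=> Us /allP wts C.
(* [cancels_sum] asks for a value attached to each key: the first term with that key supplies it,
   and [ev_key] shows that other terms with that key agree. *)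
pose v k := let t := nth (0, ([::], ([::], [::]))) ts (find (fun t => termkey (size s) t == k) ts) in
  Psi (at_ x0 s t.2.1) (cyc (at_ x0 s t.2.2.1) * cyc (at_ x0 s t.2.2.2))%g.
rewrite -[RHS](cancels_sum v C) big_map /=; apply: eq_big_seq => t tts.
rewrite /ev; congr (_ * _).
have hasP : has (fun t' => termkey (size s) t' == termkey (size s) t) ts.
  by apply/hasP; exists t.
apply: ev_key => //; first exact: wts.
  by apply: wts; rewrite mem_nth // -has_find.
by apply/esym/eqP; apply: (nth_find _ hasP).
Qed.

(** Each output of [canon] is tested to be an admissible renaming, so the soundness of [check] rests
    on this test and not on the numbering algorithm. *)
Definition checkterm N0 (z : nat * term) :=
  wf (N0 + z.1) z.2 && goodperm N0 z.1 (canon N0 (N0 + z.1) z.2).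

Definition checkpart N0 m (ts : seq term) :=
  cancels (size ts)
    [seq let t' := relabel (canon N0 (N0 + m) t) t in (termkey (N0 + m) t', t'.1)
    | t <- ts].

Definition check N0 M (zs : seq (nat * term)) :=
  all (fun z => (z.1 < M)%N && checkterm N0 z) zs
  && all (fun m => checkpart N0 m [seq z.2 | z <- zs & z.1 == m]) (iota 0 M).

(** Terms are grouped by their number of new points. Inside a group each term may be renamed on its
    own without changing its sum; after canonical renaming the summands cancel on every list [s]. *)
Lemma check_dsum b M zs : uniq b -> check (size b) M zs ->
  \sum_(z <- zs) dsum z.1 b (fun s => ev s z.2) = 0.
Proof.
move=> Ub /andP[/allP Hz /allP HM].
rewrite (eq_big_seq (fun z => \sum_(m <- iota 0 M) if z.1 == m then
   dsum m b (fun s => ev s (relabel (canon (size b) (size b + m) z.2) z.2)) else 0)).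
  rewrite exchange_big big_seq big1 //= => m mM.
  rewrite -big_mkcond -big_filter.
  rewrite -(big_map snd xpredT (fun t =>
    dsum m b (fun s => ev s (relabel (canon (size b) (size b + m) t) t)))).
  rewrite -dsum_sum -[RHS](dsum0 K m b); apply: eq_dsum => // s Us sz _.
  have := HM _ mM; rewrite /checkpart -sz => C.
  rewrite -[LHS](big_map (fun t => relabel (canon (size b) (size s) t) t) xpredT (ev s)).
  apply: cancels_ev => //; last by rewrite size_map -map_comp.
  rewrite all_map; apply/allP => _ /mapP[z + ->].
  rewrite mem_filter => /andP[/eqP Em /Hz /andP[_ /andP[wz gz]]] /=.
  rewrite Em -sz in wz gz; apply: wf_relabel => //.
  - by rewrite !size_map size_iota.
  - case/and3P: gz => _ /eqP tk dp; rewrite -(cat_take_drop (size b) (canon _ _ _)) tk.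
    rewrite (perm_uniq (perm_cat (perm_refl _) dp)).
    by rewrite -[X in iota X m]add0n -iotaD iota_uniq.
  case/and3P: gz => _ /eqP tk dp; rewrite -(cat_take_drop (size b) (canon _ _ _)) tk.
  rewrite all_cat (perm_all _ dp); apply/andP; split; apply/allP => a.
    by rewrite mem_iota sz => ?; lia.
  by rewrite mem_iota sz => ?; lia.
move=> z /Hz /andP[zM /andP[wz gz]].
rewrite (bigD1_seq z.1) ?iota_uniq ?mem_iota //= eqxx big1 ?addr0; last first.
  by move=> m; rewrite eq_sym => /negbTE->.
rewrite (dsum_relabel x0 _ Ub gz); apply: eq_dsum => // s Us sz _.
by rewrite ev_relabel // !size_map size_iota.
Qed.
End Evaluation.

(** * Three-cycles and five-cycles as cycles of lists *)

Section ThreeAndFiveCycles.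
Variable n : nat.
Implicit Types (g h : {perm 'I_n}) (i j k x : 'I_n) (s : seq 'I_n).

Lemma is_cyc3E i j k g : uniq [:: i; j; k] -> is_cyc3 i j k g = (g == cyc [:: i; j; k]).
Proof.
move=> U; have := U; rewrite /= !inE negb_or andbT => /andP[/andP[ij ik] jk].
apply/idP/eqP => [/and4P[/eqP gi /eqP gj /eqP gk /forallP gl]|->].
  apply/permP => x; rewrite cycE //.
  have := gl x; rewrite /= !inE !negb_or.
  case: (eqVneq x i) => [-> _|_] /=; first by rewrite gi.
  case: (eqVneq x j) => [-> _|_] /=; first by rewrite gj.
  by case: (eqVneq x k) => [-> _|_ /eqP->]; first by rewrite gk.
apply/and4P; split; rewrite ?cycE //=.
- by rewrite eqxx.
- by rewrite [j == i]eq_sym (negbTE ij) eqxx.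
- by rewrite [k == i]eq_sym (negbTE ik) [k == j]eq_sym (negbTE jk) eqxx.
by apply/forallP => x; apply/implyP => xs; rewrite cyc_out.
Qed.

Lemma cyc5E x1 x2 x3 x4 x5 (s := [:: x1; x2; x3; x4; x5]) : uniq s ->
  [/\ cyc s x1 = x2, cyc s x2 = x3, cyc s x3 = x4, cyc s x4 = x5 & cyc s x5 = x1].
Proof.
move=> U; have := U; rewrite /= !inE !negb_or !andbT.
case/and4P=> /and4P[e1 e2 e3 e4] /and3P[e5 e6 e7] /andP[e8 e9] e10.
have F (a c : 'I_n) : a != c -> (c == a) = false by rewrite eq_sym => /negbTE.
rewrite !cycE //= !eqxx (F _ _ e1) (F _ _ e2) (F _ _ e3) (F _ _ e4) (F _ _ e5).
by rewrite (F _ _ e6) (F _ _ e7) (F _ _ e8) (F _ _ e9) (F _ _ e10).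
Qed.

Lemma is_cyc5_cyc s : uniq s -> size s = 5%N -> is_cyc5 (cyc s).
Proof.
move=> U sz; apply/andP; split.
- case: s U sz => [|x1 [|x2 [|x3 [|x4 [|x5 [|]]]]]] // U _; set s := [:: x1; _; _; _; _] in U *.
  have [g1 g2 g3 g4 _] := cyc5E U.
  apply/existsP; exists x1; rewrite -[5%N]/(size s) -(card_uniqP U); apply/eqP/eq_card.
  move=> y; rewrite -[RHS]/(y \in s).
  apply/porbitP/idP => [[k ->]|].
    elim: k => [|k IH]; first by rewrite expg0 perm1 mem_head.
    by rewrite expgSr permM cycE // mem_next.
  rewrite !inE => /or4P[/eqP->|/eqP->|/eqP->|/orP[]/eqP->].
  + by exists 0%N; rewrite expg0 perm1.
  + by exists 1%N; rewrite expg1 g1.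
  + by exists 2%N; rewrite permX /= g1 g2.
  + by exists 3%N; rewrite permX /= g1 g2 g3.
  + by exists 4%N; rewrite permX /= g1 g2 g3 g4.
rewrite -sz -(card_uniqP U); apply/eqP/eq_card => x; rewrite !inE.
apply/idP/idP => [|xs]; first by apply: contraR => xs; rewrite cyc_out.
rewrite cycE // next_nth xs; case: s U sz xs => [|y s] // U sz xs.
have xi : (index x (y :: s) < size (y :: s))%N by rewrite index_mem.
rewrite -{2}(nth_index y xs); have [lt|ge] := ltnP (index x (y :: s)) (size s).
  by rewrite -[nth y s _]/(nth y (y :: s) (index x (y :: s)).+1) nth_uniq // gtn_eqF.
rewrite nth_default // -[y in y == _]/(nth y (y :: s) 0) nth_uniq //.
by rewrite eq_sym gtn_eqF //; apply: leq_trans ge; case: sz => ->.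
Qed.

(** An orbit of five elements consists of moved points, and exactly five points move, so it is the
    orbit of every moved point. *)
Lemma cyc5_traject g i : is_cyc5 g -> g i != i ->
  let s := traject g i 5 in uniq s /\ g = cyc s.
Proof.
case/andP=> /existsP[x /eqP ox] /eqP om gi.
have sub : porbit g x \subset [set y | g y != y].
  apply/subsetP => y; rewrite -eq_porbit_mem => /eqP E; rewrite inE.
  have := uniq_traject_porbit g y; rewrite E ox /= !inE !negb_or eq_sym.
  by case/andP=> /andP[].
have om' : porbit g x = [set y | g y != y].
  by apply/eqP; rewrite eqEcard sub ox om.
have oi : porbit g i = porbit g x.
  by apply/eqP; rewrite eq_porbit_mem om' inE.
have Ui := uniq_traject_porbit g i; have it := iter_porbit g i.
have Ti := porbit_traject g i; rewrite oi ox in Ui it Ti.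
split=> //; apply/permP => y; case: (boolP (y \in traject g i 5)) => yt; last first.
  rewrite cyc_out //; apply/eqP; move: yt; rewrite -Ti om'.
  by rewrite inE negbK.
rewrite cycE // (@nextE _ g) //; rewrite /= !eqxx /=.
by rewrite -[X in X == i]/(iter 5 g i) it eqxx.
Qed.

Lemma is_cyc5P g : reflect (exists2 s, uniq s /\ size s = 5%N & g = cyc s) (is_cyc5 g).
Proof.
apply: (iffP idP) => [c5|[s [U sz] ->]]; last exact: is_cyc5_cyc.
have /andP[_ /eqP om] := c5.
have : (0 < #|[set x | g x != x]|)%N by rewrite om.
case/card_gt0P=> i; rewrite inE => gi.
by have [U E] := cyc5_traject c5 gi; exists (traject g i 5).
Qed.

Lemma is_cyc5V g : is_cyc5 g^-1%g = is_cyc5 g.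
Proof.
have H h : is_cyc5 h -> is_cyc5 h^-1%g.
  case/is_cyc5P=> s [U sz] ->; rewrite cycV //.
  by apply: is_cyc5_cyc; rewrite ?rev_uniq ?size_rev.
by apply/idP/idP => /H; rewrite ?invgK.
Qed.

Lemma is_cyc5J g (s : {perm 'I_n}) : is_cyc5 (g ^ s)%g = is_cyc5 g.
Proof.
have H h t : is_cyc5 h -> is_cyc5 (h ^ t)%g.
  case/is_cyc5P=> r [U sz] ->; rewrite cyc_conj //.
  by apply: is_cyc5_cyc; rewrite ?map_inj_uniq ?size_map //; apply: perm_inj.
by apply/idP/idP => [/(H _ s^-1%g)|/H //]; rewrite conjgK.
Qed.

Variable K : fieldType.

(** Listing a 5-cycle from a given point that it moves makes the list unique. *)
Lemma sum_cyc5 i (psi : {perm 'I_n} -> K) :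
  \sum_(h | is_cyc5 h && (h i != i)) psi h = dsum 4 [:: i] (fun s => psi (cyc s)).
Proof.
rewrite dsum_tuple //.
pose f h : 4.-tuple 'I_n := [tuple of traject h (h i) 4].
rewrite (reindex_onto (fun t : 4.-tuple 'I_n => cyc (i :: t)) f) => [|h /andP[c5 hi]]; last first.
  by have [U E] := cyc5_traject c5 hi; rewrite {2}E.
apply: eq_bigl => t; apply/idP/idP => [/andP[/andP[c5 hi] /eqP ft]|U].
  have [U _] := cyc5_traject c5 hi; rewrite -ft.
  exact: U.
have sz : size (i :: t) = 5%N by rewrite /= size_tuple.
rewrite is_cyc5_cyc //=.
case: t U sz => -[|a [|b [|c [|d [|]]]]] // szt; rewrite -[tval _]/[:: a; b; c; d] => U _.
have [g1 g2 g3 g4 _] := cyc5E U.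
have -> : f (cyc [:: i; a; b; c; d]) == Tuple szt.
  by apply/eqP/val_inj; rewrite /= g1 g2 g3 g4.
rewrite g1 andbT.
by move: U; rewrite /= inE negb_or => /andP[/andP[]]; rewrite eq_sym.
Qed.
End ThreeAndFiveCycles.

(** * The family as sums over distinct points *)

Definition cycles3 : seq (int * seq nat) := [:: (1, [:: 0; 1; 2]%N); (-1, [:: 2; 1; 0]%N)].
(** Positions 0 and 1 stand for $i$ and $j$. The first cycle satisfies $\sigma^2(i)=j$ and the third
    $\sigma(i)=j$; each is followed by its inverse, the reversed list. *)
Definition cycles5 : seq (int * seq nat) :=
  [:: (2, [:: 0; 2; 1; 3; 4]%N); (-2, [:: 4; 3; 1; 2; 0]%N);
      (-1, [:: 0; 1; 2; 3; 4]%N); (1, [:: 4; 3; 2; 1; 0]%N)].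

Section Family.
Variables (K : fieldType) (n : nat) (a b c : K) (x0 : 'I_n).
Local Notation famL := (@kappaL K n a b).
Local Notation famC := (@kappaC K n a b c).
Local Notation atx := (at_ x0).
Implicit Types (g h : {perm 'I_n}) (i j k l x : 'I_n) (F : seq 'I_n -> {perm 'I_n} -> K).

Lemma is_cyc3_rot i j k g : is_cyc3 i j k g = is_cyc3 j k i g.
Proof.
rewrite /is_cyc3 (eq_forallb (P2 := fun l => (l \notin [:: j; k; i]) ==> (g l == l))).
  by case: (g i == j); case: (g j == k); case: (g k == i).
by move=> l; rewrite !inE; congr (~~ _ ==> _); rewrite [in RHS]orbA [in RHS]orbC.
Qed.

Lemma is_cyc3J i j k g (s : {perm 'I_n}) :
  is_cyc3 (s i) (s j) (s k) (g ^ s)%g = is_cyc3 i j k g.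
Proof.
rewrite /is_cyc3 !permJ !(inj_eq (@perm_inj _ s)); do 3!congr (_ && _).
apply/forallP/forallP => H l.
  by have := H (s l); rewrite permJ !inE !(inj_eq (@perm_inj _ s)).
rewrite -[l](permKV s); move: (H ((s^-1)%g l)).
by rewrite permJ !inE !(inj_eq (@perm_inj _ s)).
Qed.

Lemma family_alternatingL : alternatingL famL.
Proof.
move=> g i j l; rewrite /kappaL eqxx; split=> //; rewrite eq_sym.
case: eqP => _; rewrite ?oppr0 // -sumrN.
apply: eq_big => [k|k _]; first by rewrite andbC.
rewrite -(is_cyc3_rot k j i) (is_cyc3_rot k i j) -mulNr opprB.
by congr (_ * _); rewrite !inE orbCA.
Qed.

Lemma family_alternatingC : alternatingC famC.
Proof.
move=> g i j; rewrite /kappaC eqxx; split=> //; rewrite eq_sym.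
case: eqP => _; rewrite ?oppr0 //.
have e1 (h : {perm 'I_n}) x y : (h x == y) = ((h^-1)%g y == x).
  by rewrite -(inj_eq (@perm_inj _ (h^-1)%g)) permK eq_sym.
have e2 (h : {perm 'I_n}) x y : (h (h x) == y) = ((h^-1)%g ((h^-1)%g y) == x).
  by rewrite e1 eq_sym e1 eq_sym.
rewrite (eq_bigl (fun k => (k != i) && (k != j))); last by move=> k; rewrite andbC.
rewrite (eq_bigr (fun k => - ((is_cyc3 i j k g)%:R - (is_cyc3 k j i g)%:R))).
  rewrite sumrN !is_cyc5V (e1 g j i) (e2 g j i) (e1 (g^-1)%g j i) (e2 (g^-1)%g j i).
  by rewrite !invgK; ring.
by move=> k _; rewrite -(is_cyc3_rot k j i) (is_cyc3_rot k i j) opprB.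
Qed.

Lemma family_invariantL : invariantL famL.
Proof.
move=> s g i j l; rewrite /kappaL (inj_eq (@perm_inj _ s)); case: eqP => // _.
rewrite (reindex_inj (@perm_inj _ s)) /=.
apply: eq_big => [k|k _]; first by rewrite !(inj_eq (@perm_inj _ s)).
by rewrite !is_cyc3J !inE !(inj_eq (@perm_inj _ s)).
Qed.

Lemma family_invariantC : invariantC famC.
Proof.
move=> s g i j; rewrite /kappaC (inj_eq (@perm_inj _ s)); case: eqP => // _.
rewrite (reindex_inj (@perm_inj _ s)) /= -conjVg !is_cyc5J !permJ.
rewrite !(inj_eq (@perm_inj _ s)); congr (_ * _ + _).
apply: eq_big => [k|k _]; first by rewrite !(inj_eq (@perm_inj _ s)).
by rewrite !is_cyc3J.
Qed.

(** The weights [a] on [s] and [b] off [s] are rewritten as [a - b] on [s] plus [b] everywhere,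
    which isolates the sum of all basis vectors. *)
Definition famval F (s : seq 'I_n) h : K :=
  (a - b) * (\sum_(v <- s) F [:: v] h) + (b * (\sum_v F [:: v] h) + c * F [::] h).

Lemma sum_cyc3 i j k (psi : {perm 'I_n} -> K) : uniq [:: i; j; k] ->
  \sum_h (is_cyc3 i j k h)%:R * psi h = psi (cyc [:: i; j; k]).
Proof.
move=> U; rewrite (bigD1 (cyc [:: i; j; k])) //= is_cyc3E // eqxx mul1r.
by rewrite big1 ?addr0 // => h; rewrite is_cyc3E // => /negbTE->; rewrite mul0r.
Qed.

(** The renaming [p] makes the point computed by [f] the first new one; the condition [f h == j]
    then fixes it and leaves three free points. Permutations fixing [i] drop out because
    [i != j]. *)
Lemma sum_cyc5_step i j (psi : {perm 'I_n} -> K) (f : {perm 'I_n} -> 'I_n) p :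
  i != j -> goodperm 1 4 p -> (forall h, h i = i -> f h = i) ->
  (forall x y z t, uniq [:: i; x; y; z; t] ->
     f (cyc (atx [:: i; x; y; z; t] p)) = x) ->
  \sum_h (is_cyc5 h && (f h == j))%:R * psi h =
  dsum 3 [:: i; j] (fun s => psi (cyc (atx s p))).
Proof.
move=> ij gp fi fp.
transitivity (\sum_(h | is_cyc5 h && (h i != i)) (f h == j)%:R * psi h).
  rewrite [RHS]big_mkcond; apply: eq_bigr => h _; case: (is_cyc5 h); rewrite ?mul0r //=.
  by case: (eqVneq (h i) i) => [/fi->|_] //=; rewrite (negbTE ij) mul0r.
rewrite sum_cyc5 (@dsum_relabel _ _ x0 4 [:: i] _ p) //.
rewrite dsumS.
rewrite (eq_bigr (fun x => (x == j)%:R * dsum 3 [:: i; x] (fun s => psi (cyc (atx s p))))).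
  rewrite (bigD1 j) /=; last by rewrite inE eq_sym.
  by rewrite eqxx mul1r big1 ?addr0 // => x /andP[_ /negbTE->]; rewrite mul0r.
move=> x; rewrite inE => xi; rewrite -dsumZ; apply: eq_dsum => [|s Us].
  by rewrite /= inE eq_sym xi.
case: s Us => [|i' [|x' [|y [|z [|t [|]]]]]] // Us _ /= [? ?]; subst i' x'.
by rewrite fp.
Qed.

Lemma sum_inv_cyc5 (psi : {perm 'I_n} -> K) (P : pred {perm 'I_n}) :
  \sum_h (is_cyc5 (h^-1)%g && P (h^-1)%g)%:R * psi h =
  \sum_h (is_cyc5 h && P h)%:R * psi (h^-1)%g.
Proof.
by rewrite (reindex_inj invg_inj); apply: eq_bigr => h _; rewrite invgK.
Qed.

(** Trades the sum over all permutations for sums over the remaining points of the cycles, the form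
    that can be coded. *)
Lemma kapply_family i j F : i != j ->
  kapply famL famC i j F =
  dsum 1 [:: i; j] (fun s => \sum_(e <- cycles3) e.1%:~R * famval F s (cyc (atx s e.2)))
  + (a - b) ^+ 2 *
    dsum 3 [:: i; j] (fun s => \sum_(e <- cycles5) e.1%:~R * F [::] (cyc (atx s e.2))).
Proof.
move=> ij.
transitivity (\sum_(k | k \notin [:: i; j]) \sum_h
    ((is_cyc3 i j k h)%:R - (is_cyc3 k j i h)%:R) * famval F [:: i; j; k] h
  + (a - b) ^+ 2 * \sum_h
    (2 * ((is_cyc5 h && (h (h i) == j))%:R
          - (is_cyc5 (h^-1)%g && ((h^-1)%g ((h^-1)%g i) == j))%:R)
     - ((is_cyc5 h && (h i == j))%:R - (is_cyc5 (h^-1)%g && ((h^-1)%g i == j))%:R)) * F [::] h).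
  rewrite exchange_big mulr_sumr -big_split; apply: eq_bigr => h _ /=.
  rewrite /kappaC (negbTE ij) mulrDl -mulrA addrA; congr (_ + _); last by rewrite mulrA.
  rewrite mulr_suml mulr_sumr.
  under eq_bigr => l _.
    rewrite /kappaL (negbTE ij) mulr_suml; over.
  rewrite exchange_big -big_split /=.
  apply: eq_big => [k|k kij]; first by rewrite !inE negb_or.
  have Us : uniq [:: i; j; k].
    by rewrite /= !inE negb_or ij andbT (eq_sym i k) (eq_sym j k).
  under eq_bigr do rewrite -mulrA.
  rewrite -mulr_sumr mulrCA -mulrDr; congr (_ * _); rewrite /famval addrA; congr (_ + _).
  rewrite [X in (a - b) * X]big_uniq //= !mulr_sumr [X in _ = X + _]big_mkcond -big_split /=.
  by apply: eq_bigr => l _; case: ifP => _; ring.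
congr (_ + _ * _).
  apply: eq_bigr => k kij.
  have Us : uniq [:: i; j; k].
    by move: kij; rewrite /= !inE !negb_or ij andbT (eq_sym i k) (eq_sym j k).
  have Us' : uniq [:: k; j; i] by rewrite -(rev_uniq [:: i; j; k]) in Us.
  rewrite !big_cons big_nil addr0 /= mul1r mulN1r.
  under eq_bigr do rewrite mulrBl.
  by rewrite sumrB !sum_cyc3.
have step1 (psi : {perm 'I_n} -> K) : \sum_h (is_cyc5 h && (h i == j))%:R * psi h =
    dsum 3 [:: i; j] (fun s => psi (cyc (atx s [:: 0; 1; 2; 3; 4]%N))).
  by apply: (@sum_cyc5_step i j psi (fun h => h i) [:: 0; 1; 2; 3; 4]%N) => // x y z t /cyc5E[].
have step2 (psi : {perm 'I_n} -> K) : \sum_h (is_cyc5 h && (h (h i) == j))%:R * psi h =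
    dsum 3 [:: i; j] (fun s => psi (cyc (atx s [:: 0; 2; 1; 3; 4]%N))).
  apply: (@sum_cyc5_step i j psi (fun h => h (h i)) [:: 0; 2; 1; 3; 4]%N ij isT) => [h hi|x y z t U].
    by rewrite !hi.
  have U' : uniq [:: i; y; x; z; t].
    by move: U; congr is_true; apply: perm_uniq; rewrite perm_cons (permEl (perm_catCA [:: x] [:: y] _)).
  by rewrite -[atx _ _]/[:: i; y; x; z; t]; have [-> -> _ _ _] := cyc5E U'.
have inv5 p : codecycle 5 p -> dsum 3 [:: i; j] (fun s => F [::] (cyc (atx s p))^-1%g) =
    dsum 3 [:: i; j] (fun s => F [::] (cyc (atx s (rev p)))).
  move=> wp; apply: eq_dsum; first by rewrite /= inE ij.
  by move=> s Us sz _; rewrite cycV ?at_uniq ?sz // /at_ map_rev.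
under eq_bigr do rewrite mulrBl !mulrBr !mulrBl -!mulrA.
rewrite !sumrB -!mulr_sumr.
rewrite (sum_inv_cyc5 _ (fun h => h (h i) == j)) (sum_inv_cyc5 _ (fun h => h i == j)).
rewrite !step1 !step2 !inv5 // (dsum_sum cycles5) !big_cons big_nil /= !dsumZ.
by ring.
Qed.
End Family.

(** * The coded identities *)

Definition words0 (cs : seq (int * seq nat)) : seq (int * (seq nat * seq nat)) :=
  [seq (e.1, ([::], e.2)) | e <- cs].
Definition words1 (cs : seq (int * seq nat)) : seq (int * (seq nat * seq nat)) :=
  [seq (e.1, ([:: w], e.2)) | e <- cs, w <- [:: 0; 1; 2]%N].

(** Inner sum over [r] indices behind a fixed outer cycle [c1], expanded by the coincidences of
    these indices with the [N] points named so far. *)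
Definition codegen r N A c1 (cs : seq (int * (seq nat * seq nat))) : seq (nat * term) :=
  [seq (c.1, (e.1, (map (nth 0%N c.2) e.2.1, (c1, map (nth 0%N c.2) e.2.2))))
  | c <- choices r N A, e <- cs].

(** Commutators of cycles [h] with e_l: moving e_l across [h] replaces it by e_(h l), which leaves
    two one-letter terms and an empty second cycle. *)
Definition codebracket r N A l (cs : seq (int * seq nat)) : seq (nat * term) :=
  flatten [seq flatten [seq let c' := map (nth 0%N c.2) e.2 in
    [:: (c.1, (e.1, ([:: next c' l], (c', [::]))));
        (c.1, (- e.1, ([:: l], (c', [::]))))] | e <- cs]
  | c <- choices r N A].

Definition codescale (k : int) (zs : seq (nat * term)) : seq (nat * term) :=
  [seq (z.1, (k * z.2.1, z.2.2)) | z <- zs].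
(** An outer summation index counts as one more new point. *)
Definition codeshift (zs : seq (nat * term)) : seq (nat * term) :=
  [seq (z.1.+1, z.2) | z <- zs].

Definition triples : seq (nat * nat * nat) := [:: (0, 1, 2); (1, 2, 0); (2, 0, 1)]%N.

(* The points [0, 1, 2] code the three arguments of the Jacobi identity and [3]
   the third point of the outer 3-cycle. *)
Definition jacterms r cs : seq (nat * term) :=
  flatten [seq flatten [seq flatten [seq codeshift (codescale e.1
       (codegen r 4 [:: v; x.2] (map (nth 0%N [:: x.1.1; x.1.2; 3%N]) e.2) cs))
     | v <- [:: x.1.1; x.1.2; 3%N]] | e <- cycles3] | x <- triples].

Definition jacbracket : seq (nat * term) :=
  flatten [seq codebracket 3 3 [:: x.1.1; x.1.2] x.2 cycles5 | x <- triples].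

(** Position 0 is the fixed index and position 1 the summed one. *)
Definition omegaterms r cs : seq (nat * term) :=
  codeshift (codegen r 2 [:: 1%N; 0%N] [::] cs).

(** Coefficient of [(a - b) ^+ 2]: the coefficients 2 and -1 of the 5-cycles balance the products of
    two 3-cycles. The next two checks treat the central factor and [(a - b) ^+ 3]. The second
    argument is a strict bound on the number of new points. *)
Lemma check_jac1 : check 3 4 (jacterms 1 (words1 cycles3) ++ jacbracket).
Proof. by vm_compute. Qed.
Lemma check_jac0 : check 3 3 (jacterms 1 (words0 cycles3)).
Proof. by vm_compute. Qed.
Lemma check_jac5 : check 3 5 (jacterms 3 (words0 cycles5)).
Proof. by vm_compute. Qed.
Lemma check_omega1 : check 1 3 (omegaterms 1 (words1 cycles3)).
Proof. by vm_compute. Qed.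
Lemma check_omega0 : check 1 3 (omegaterms 1 (words0 cycles3)).
Proof. by vm_compute. Qed.
Lemma check_omega5 : check 1 5 (omegaterms 3 (words0 cycles5)).
Proof. by vm_compute. Qed.

Lemma size_choices r N A c : c \in choices r N A -> size c.2 = (size A + r)%N.
Proof.
elim: r N A c => [|r IH] N A c /=; first by rewrite inE => /eqP->; rewrite addn0.
rewrite mem_cat => /orP[/flattenP[_ /mapP[a _ ->]]|/mapP[c' cc ->]] /=.
  by move/IH; rewrite size_rcons addnS.
by rewrite (IH _ _ _ cc) size_rcons addnS.
Qed.

(** * Translation of sums into codes *)

Section CodedSums.
Variables (K : fieldType) (T : finType) (x0 : T).
Implicit Types (s b : seq T) (Psi : seq T -> {perm T} -> K).
Local Notation atx := (at_ x0).

Definition wfcode N (e : int * (seq nat * seq nat)) :=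
  all (fun a => a < N)%N e.2.1 && all (fun a => a < N)%N e.2.2.

Lemma at_prefix b s p : take (size b) s = b -> all (fun a => a < size b)%N p ->
  atx b p = atx s p.
Proof.
move=> E /allP H; apply/eq_in_map => a /H ab.
by rewrite -[in LHS]E nth_take.
Qed.

Lemma dsum_terms Psi r b A c1 cs : uniq b -> all (fun a => a < size b)%N A ->
  all (fun a => a < size b)%N c1 -> all (wfcode (size A + r)) cs ->
  dsum r (atx b A) (fun s => \sum_(e <- cs)
    e.1%:~R * Psi (atx s e.2.1) (cyc (atx b c1) * cyc (atx s e.2.2))%g) =
  \sum_(z <- codegen r (size b) A c1 cs) dsum z.1 b (fun s => ev x0 Psi s z.2).
Proof.
move=> Ub HA H1 /allP Hcs; rewrite dsum_choices // big_allpairs_dep.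
apply: eq_big_seq => d /size_choices sd /=.
rewrite -dsum_sum; apply: eq_dsum => // s Us sz pre.
apply: eq_big_seq => e /Hcs /andP[w1 w2].
by rewrite /ev /= !at_comp ?sd // (at_prefix pre H1).
Qed.

Lemma dsum_bracket Psi r b A l cs : uniq b -> all (fun a => a < size b)%N A ->
  (l < size b)%N -> all (fun e => codecycle (size A + r) e.2) cs ->
  all (fun d => codecycle (size b + d.1) d.2) (choices r (size b) A) ->
  dsum r (atx b A) (fun s => \sum_(e <- cs)
    e.1%:~R * (Psi [:: cyc (atx s e.2) (nth x0 b l)] (cyc (atx s e.2))
               - Psi [:: nth x0 b l] (cyc (atx s e.2)))) =
  \sum_(z <- codebracket r (size b) A l cs) dsum z.1 b (fun s => ev x0 Psi s z.2).
Proof.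
move=> Ub HA Hl /allP Hcs /allP Hch; rewrite dsum_choices // big_flatten big_map.
apply: eq_big_seq => d dch; have sd := size_choices dch.
have /andP[Ud /allP Hd] := Hch _ dch.
rewrite big_flatten big_map dsum_sum; apply: eq_big_seq => e /Hcs /andP[ue we].
rewrite /= !big_cons big_nil addr0 -dsumD; apply: eq_dsum => // s Us sz pre.
have ls : (l < size s)%N by rewrite sz ltn_addr.
have wfe : codecycle (size s) (map (nth 0%N d.2) e.2).
  rewrite /codecycle map_inj_in_uniq ?ue.
    apply/allP => _ /mapP[a ae ->]; rewrite sz; apply: Hd.
    by rewrite mem_nth // sd (allP we).
  move=> a a' /(allP we) sa /(allP we) sa' /eqP.
  by rewrite nth_uniq ?sd // => /eqP.
rewrite /ev /= !at_comp ?sd // cyc0 mulg1 mulrNz.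
have -> : nth x0 b l = nth x0 s l by rewrite -[in LHS]pre nth_take.
by rewrite cyc_at // mulrBr mulNr.
Qed.

Lemma sum_codescale Psi k b zs :
  \sum_(z <- codescale k zs) dsum z.1 b (fun s => ev x0 Psi s z.2) =
  k%:~R * \sum_(z <- zs) dsum z.1 b (fun s => ev x0 Psi s z.2).
Proof.
rewrite big_map mulr_sumr; apply: eq_bigr => z _; rewrite -dsumZ /=.
by congr (dsum _ _); rewrite /ev /= intrM; apply: boolp.funext => s; rewrite mulrA.
Qed.

Lemma sum_codeshift Psi b zs :
  \sum_(z <- codeshift zs) dsum z.1 b (fun s => ev x0 Psi s z.2) =
  \sum_(x | x \notin b) \sum_(z <- zs) dsum z.1 (rcons b x) (fun s => ev x0 Psi s z.2).
Proof. by rewrite big_map [RHS]exchange_big; apply: eq_bigr => z _; rewrite dsumS. Qed.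
End CodedSums.

(** * The Jacobi identity for the family *)

Section FamilyJacobi.
Variables (K : fieldType) (n : nat) (a b c : K) (x0 : 'I_n).
Local Notation famL := (@kappaL K n a b).
Local Notation famC := (@kappaC K n a b c).
Local Notation atx := (at_ x0).
Implicit Types (g h : {perm 'I_n}) (i j k l v x : 'I_n) (F Psi : seq 'I_n -> {perm 'I_n} -> K).

Definition twopoint r cs Psi v l g : K :=
  dsum r [:: v; l] (fun s => \sum_(e <- cs)
    e.1%:~R * Psi (atx s e.2.1) (g * cyc (atx s e.2.2))%g).

(** The central factor: [b] times the sum of all basis vectors, plus the scalar [c]. *)
Definition zeta F h : K := b * (\sum_v F [:: v] h) + c * F [::] h.

Lemma kapply_twopoint F v l g : v != l ->
  kapply famL famC v l (fun w h => F w (g * h)%g) =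
  (a - b) * twopoint 1 (words1 cycles3) F v l g
  + twopoint 1 (words0 cycles3) (fun=> zeta F) v l g
  + (a - b) ^+ 2 * twopoint 3 (words0 cycles5) F v l g.
Proof.
move=> vl; have U : uniq [:: v; l] by rewrite /= inE vl.
rewrite (kapply_family _ _ _ x0) //; congr (_ + _ * _); last first.
  by apply: eq_dsum => // s _ _ _; rewrite big_map.
rewrite /twopoint -dsumZ -dsumD; apply: eq_dsum => // s Us sz _.
case: s Us sz => [|v' [|l' [|m [|]]]] // Us _.
rewrite /words1 /words0 /cycles3 /= !big_cons !big_nil /= /famval /zeta !big_cons !big_nil.
by rewrite /=; ring.
Qed.

Lemma sum_twopoint r cs Psi l : all (wfcode (2 + r)) cs ->
  \sum_(v | v != l) twopoint r cs Psi v l 1%g =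
  \sum_(z <- omegaterms r cs) dsum z.1 [:: l] (fun s => ev x0 Psi s z.2).
Proof.
move=> wcs; rewrite sum_codeshift; apply: eq_big => [v|v vl]; first by rewrite inE.
have := @dsum_terms K _ x0 Psi r [:: l; v] [:: 1%N; 0%N] [::] cs.
move=> <- //; first by rewrite /twopoint /= cyc0.
by rewrite /= inE eq_sym vl.
Qed.

(* The sum of all basis vectors is central. *)
Lemma kapply_omega F l : \sum_v kapply famL famC v l F = 0.
Proof.
rewrite (bigD1 l) //= (kapply_diag (@family_alternatingL _ _ a b) (@family_alternatingC _ _ a b c)).
rewrite add0r (eq_bigr (fun v => (a - b) * twopoint 1 (words1 cycles3) F v l 1%g
  + twopoint 1 (words0 cycles3) (fun=> zeta F) v l 1%g
  + (a - b) ^+ 2 * twopoint 3 (words0 cycles5) F v l 1%g)).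
  rewrite !big_split /= -!mulr_sumr !sum_twopoint //.
  rewrite (@check_dsum _ _ x0 _ [:: l] _ _ isT check_omega1) (@check_dsum _ _ x0 _ [:: l] _ _ isT check_omega0).
  by rewrite (@check_dsum _ _ x0 _ [:: l] _ _ isT check_omega5) !mulr0 !addr0.
move=> v vl; rewrite -kapply_twopoint //.
by apply: eq_kapply => w h _; rewrite mul1g.
Qed.

(** Contribution of the outer 3-cycles that avoid [l]: these commute with e_l, so only commutators
    of their letters with e_l remain. *)
Definition jacsum r cs Psi i j l : K :=
  \sum_(k | k \notin [:: i; j; l]) \sum_(e <- cycles3)
    e.1%:~R * \sum_(v <- [:: i; j; k]) twopoint r cs Psi v l (cyc (atx [:: i; j; k] e.2)).

Lemma jacsum_terms r cs Psi i j l : uniq [:: i; j; l] -> all (wfcode (2 + r)) cs ->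
  jacsum r cs Psi i j l + jacsum r cs Psi j l i + jacsum r cs Psi l i j =
  \sum_(z <- jacterms r cs) dsum z.1 [:: i; j; l] (fun s => ev x0 Psi s z.2).
Proof.
move=> U wcs.
have E (x : nat * nat * nat) : x \in triples ->
    jacsum r cs Psi (nth x0 [:: i; j; l] x.1.1) (nth x0 [:: i; j; l] x.1.2)
      (nth x0 [:: i; j; l] x.2) =
    \sum_(z <- flatten [seq flatten [seq codeshift (codescale e.1
       (codegen r 4 [:: d; x.2] (map (nth 0%N [:: x.1.1; x.1.2; 3%N]) e.2) cs))
     | d <- [:: x.1.1; x.1.2; 3%N]] | e <- cycles3])
     dsum z.1 [:: i; j; l] (fun s => ev x0 Psi s z.2).
  move=> xt; pose L := [:: x.1.1; x.1.2; 3%N].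
  have [HL x2 mx] : [/\ all (fun a => a < 4)%N L, (x.2 < 3)%N &
      forall k, (k \in atx [:: i; j; l] [:: x.1.1; x.1.2; x.2]) = (k \in [:: i; j; l])].
    move: xt; rewrite !inE /L => /or3P[]/eqP->; split=> //= k; rewrite !inE.
    - by rewrite orbA orbC.
    - by rewrite orbC -orbA.
  rewrite big_flatten big_map /jacsum exchange_big; apply: eq_big_seq => e ec.
  have He : all (fun a => a < 3)%N e.2 by move: ec; rewrite !inE => /orP[]/eqP->.
  rewrite big_flatten big_map.
  under [RHS]eq_bigr do rewrite sum_codeshift.
  rewrite exchange_big /=; apply: eq_big => [k|k]; first by rewrite -mx.
  rewrite mx => kb; have Ub : uniq [:: i; j; l; k].
    by rewrite -[X in uniq X]/(rcons [:: i; j; l] k) rcons_uniq kb.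
  have -> : [:: nth x0 [:: i; j; l] x.1.1; nth x0 [:: i; j; l] x.1.2; k] = atx [:: i; j; l; k] L.
    by move: xt; rewrite !inE /L => /or3P[]/eqP->.
  under [RHS]eq_bigr do rewrite sum_codescale.
  rewrite -mulr_sumr; congr (_ * _); rewrite at_comp // big_map.
  apply: eq_big_seq => v vL; have v4 : (v < 4)%N := allP HL v vL.
  rewrite -[4%N]/(size [:: i; j; l; k]) -dsum_terms //.
  - rewrite /twopoint; congr (dsum _ [:: _; _] _).
    by rewrite -[X in nth x0 X x.2]/(take 3 [:: i; j; l; k]) nth_take.
  - by rewrite /= v4 (ltn_trans x2).
  - apply/allP => _ /mapP[d de ->]; apply: (allP HL); rewrite mem_nth //.
    exact: (allP He).
rewrite /jacterms big_flatten big_map -(eq_big_seq _ E).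
by rewrite /triples !big_cons big_nil /= addr0 addrA.
Qed.

Definition brackets F i j l : K :=
  dsum 3 [:: i; j] (fun s => \sum_(e <- cycles5)
    e.1%:~R * (F [:: cyc (atx s e.2) l] (cyc (atx s e.2)) - F [:: l] (cyc (atx s e.2)))).

Lemma brackets_terms F i j l : uniq [:: i; j; l] ->
  brackets F i j l + brackets F j l i + brackets F l i j =
  \sum_(z <- jacbracket) dsum z.1 [:: i; j; l] (fun s => ev x0 F s z.2).
Proof.
move=> U.
have E (x : nat * nat * nat) : x \in triples ->
    brackets F (nth x0 [:: i; j; l] x.1.1) (nth x0 [:: i; j; l] x.1.2)
      (nth x0 [:: i; j; l] x.2) =
    \sum_(z <- codebracket 3 3 [:: x.1.1; x.1.2] x.2 cycles5)
     dsum z.1 [:: i; j; l] (fun s => ev x0 F s z.2).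
  move=> xt; rewrite -[X in codebracket _ X]/(size [:: i; j; l]).
  by rewrite -dsum_bracket //; move: xt; rewrite !inE => /or3P[]/eqP->.
rewrite /jacbracket big_flatten big_map -(eq_big_seq _ E).
by rewrite /triples !big_cons big_nil /= addr0 addrA.
Qed.

Lemma dsum1_split (f : seq 'I_n -> K) i j l : uniq [:: i; j; l] ->
  dsum 1 [:: i; j] f = f [:: i; j; l] + \sum_(k | k \notin [:: i; j; l]) f [:: i; j; k].
Proof.
rewrite /= !inE negb_or => /and3P[/andP[ij il] jl _].
rewrite dsumS (bigD1 l) /=; last by rewrite !inE negb_or eq_sym il eq_sym jl.
congr (_ + _); apply: eq_bigl => k; rewrite !inE !negb_or.
by rewrite andbA.
Qed.

(** For distinct indices the Jacobi element is split by whether the outer 3-cycle contains the third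
    index, and then by powers of [a - b]. The terms [A] and [B] cancel by cyclic symmetry, the
    others by the checks. *)
Lemma family_jacobi : jacobi famL famC.
Proof.
have alt := kapply_alt (@family_alternatingL _ _ a b) (@family_alternatingC _ _ a b c).
have diag := kapply_diag (@family_alternatingL _ _ a b) (@family_alternatingC _ _ a b c).
move=> phi Rphi i j l J.
have altJ x y z : J x y z = - J y x z by apply: alt.
have diagJ x z : J x x z = 0 by apply: diag.
have [->|ij] := eqVneq i j; first by rewrite diagJ add0r (altJ l j) subrr.
have [->|jl] := eqVneq j l; first by rewrite diagJ addr0 (altJ l i) subrr.
have [->|il] := eqVneq i l; first by rewrite diagJ addr0 (altJ j l) subrr.
have U : uniq [:: i; j; l] by rewrite /= !inE negb_or ij il jl.
pose KP v l g := kapply famL famC v l (fun w h => phi w (g * h)%g).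
have KPE v z g : phi [:: v; z] g - phi [:: z; v] g = KP v z g.
  have /= -> := Rphi [::] v z [::] g isT.
  by apply: eq_kapply => w h _; rewrite cats0.
have KPalt v z g : KP v z g = - KP z v g by apply: alt.
have KPdiag v g : KP v v g = 0 by apply: diag.
(* [G] measures the failure of [h] to commute with e_z. For the outer 3-cycle on [x], [y], [z], the
   sum [A] collects this action and [B] the reordering of its letters with e_z. *)
pose G z w h := phi (rcons w (h z)) h - phi (rcons w z) h.
pose A x y z := \sum_(e <- cycles3)
  e.1%:~R * famval a b c (G z) [:: x; y; z] (cyc (atx [:: x; y; z] e.2)).
pose B x y z := \sum_(e <- cycles3)
  e.1%:~R * (KP x z (cyc (atx [:: x; y; z] e.2)) + KP y z (cyc (atx [:: x; y; z] e.2))).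
have JE x y z : uniq [:: x; y; z] -> J x y z = A x y z + (a - b) * B x y z
   + (a - b) ^+ 2 * jacsum 1 (words1 cycles3) phi x y z
   + (a - b) * jacsum 1 (words0 cycles3) (fun=> zeta phi) x y z
   + (a - b) ^+ 3 * jacsum 3 (words0 cycles5) phi x y z
   + (a - b) ^+ 2 * brackets phi x y z.
  move=> Us; have := Us; rewrite /= !inE negb_or => /and3P[/andP[xy xz] yz _].
  pose F w h := phi (rcons w (h z)) h - phi (z :: w) h.
  have famE s h : famval a b c F s h =
      famval a b c (G z) s h + (a - b) * \sum_(v <- s) KP v z h.
    have FE v : F [:: v] h = G z [:: v] h + KP v z h.
      by rewrite /F /G -KPE /=; ring.
    (* Centrality of the sum of all letters removes the reordering terms of weight [b]. *)
    have om : \sum_v KP v z h = 0 by apply: kapply_omega.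
    rewrite /famval; under eq_bigr do rewrite FE.
    under [in X in _ + X]eq_bigr do rewrite FE.
    rewrite !big_split /= om /F /G /=; ring.
  rewrite /J -/F (kapply_family _ _ _ x0) // (dsum1_split _ Us).
  congr (_ + _).
  have -> : \sum_(e <- cycles3) e.1%:~R * famval a b c F [:: x; y; z] (cyc (atx [:: x; y; z] e.2)) =
      A x y z + (a - b) * B x y z.
    rewrite /A /B mulr_sumr -big_split /=; apply: eq_bigr => e _.
    by rewrite famE !big_cons big_nil KPdiag addr0 mulrDr addr0 mulrCA.
  rewrite -!addrA; do 2!congr (_ + _).
  rewrite /jacsum !mulr_sumr -!big_split /=; apply: eq_bigr => k kxyz.
  rewrite !mulr_sumr -!big_split /=; apply: eq_big_seq => e ec.
  have Uk : uniq [:: x; y; k].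
    by move: kxyz; rewrite /= !inE !negb_or xy (eq_sym x k) (eq_sym y k) => /and3P[-> -> _].
  have zk : z \notin [:: x; y; k].
    by move: kxyz; rewrite !inE !negb_or (eq_sym z x) (eq_sym z y) (eq_sym z k) xz yz => /and3P[].
  have ce : codecycle 3 e.2 by move: ec; rewrite !inE => /orP[]/eqP->.
  set h := cyc _; have hz : h z = z.
    rewrite cyc_out ?at_uniq //; apply: contra zk; apply: mem_at_sub.
    by case/andP: ce.
  have G0 w : G z w h = 0 by rewrite /G hz subrr.
  rewrite famE /famval big1 => [|v _]; last exact: G0.
  rewrite big1 => [|v _]; last exact: G0.
  rewrite G0 !mulr0 !add0r (eq_big_seq (fun v => (a - b) * twopoint 1 (words1 cycles3) phi v z h
    + twopoint 1 (words0 cycles3) (fun=> zeta phi) v z h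
    + (a - b) ^+ 2 * twopoint 3 (words0 cycles5) phi v z h)) => [|v vk]; last first.
    by rewrite -kapply_twopoint //; apply: contraNneq zk => <-.
  by rewrite !big_split /= -!mulr_sumr; ring.
have Ur1 : uniq [:: j; l; i] by rewrite -(rot_uniq 1) in U.
have Ur2 : uniq [:: l; i; j] by rewrite -(rot_uniq 1) in Ur1.
have Uv : uniq [:: l; j; i] by rewrite -(rev_uniq [:: i; j; l]) in U.
have rotc e : e \in cycles3 ->
    cyc (atx [:: j; l; i] e.2) = cyc (atx [:: i; j; l] e.2) /\
    cyc (atx [:: l; i; j] e.2) = cyc (atx [:: i; j; l] e.2).
  have cr (s : seq 'I_n) m : uniq s -> cyc (rot m s) = cyc s.
    by move=> Us; apply/permP => x; rewrite !cycE ?rot_uniq // next_rot.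
  rewrite !inE => /orP[]/eqP->; rewrite /at_ /=.
    by split; [apply: (cr _ 1%N U) | apply: (cr _ 2%N U)].
  by split; [apply: (cr _ 2%N Uv) | apply: (cr _ 1%N Uv)].
have B0 : B i j l + B j l i + B l i j = 0.
  rewrite /B -!big_split big_seq big1 //= => e /rotc[-> ->].
  rewrite (KPalt j i) (KPalt l i) (KPalt l j); ring.
have A0 : A i j l + A j l i + A l i j = 0.
  rewrite /A -!big_split big_seq big1 //= => e ec; have [-> ->] := rotc _ ec.
  rewrite -!mulrDr; set h := cyc _.
  (* As [h] permutes [i], [j], [l] cyclically, the three differences telescope. *)
  have G0 w : G j w h = - G l w h - G i w h.
    have c3 x y z : uniq [:: x; y; z] -> is_cyc3 x y z (cyc [:: x; y; z]).
      by move=> Us; rewrite is_cyc3E.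
    rewrite /G /h; move: ec; rewrite !inE => /orP[]/eqP->; rewrite /at_ /=.
      by have /and4P[/eqP-> /eqP-> /eqP-> _] := c3 _ _ _ U; ring.
    by have /and4P[/eqP-> /eqP-> /eqP-> _] := c3 _ _ _ Uv; ring.
  have S0 : \sum_v G j [:: v] h = - (\sum_v G l [:: v] h) - \sum_v G i [:: v] h.
    by rewrite -sumrN -sumrB; apply: eq_bigr => v _; apply: G0.
  by rewrite /famval S0 !big_cons !big_nil !G0; ring.
have J1 : jacsum 1 (words1 cycles3) phi i j l + jacsum 1 (words1 cycles3) phi j l i
    + jacsum 1 (words1 cycles3) phi l i j
    + (brackets phi i j l + brackets phi j l i + brackets phi l i j) = 0.
  rewrite jacsum_terms // brackets_terms // -big_cat.
  exact: check_dsum U check_jac1.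
have J0 : jacsum 1 (words0 cycles3) (fun=> zeta phi) i j l
    + jacsum 1 (words0 cycles3) (fun=> zeta phi) j l i
    + jacsum 1 (words0 cycles3) (fun=> zeta phi) l i j = 0.
  by rewrite jacsum_terms //; exact: check_dsum U check_jac0.
have J5 : jacsum 3 (words0 cycles5) phi i j l + jacsum 3 (words0 cycles5) phi j l i
    + jacsum 3 (words0 cycles5) phi l i j = 0.
  by rewrite jacsum_terms //; exact: check_dsum U check_jac5.
rewrite !JE //.
move: A0 B0 J1 J0 J5.
set A1 := A _ _ _; set A2 := A _ _ _; set A3 := A _ _ _.
set B1 := B _ _ _; set B2 := B _ _ _; set B3 := B _ _ _.
set j1 := jacsum _ _ _ _ _ _; set j2 := jacsum _ _ _ _ _ _; set j3 := jacsum _ _ _ _ _ _.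
set b1 := brackets _ _ _ _; set b2 := brackets _ _ _ _; set b3 := brackets _ _ _ _.
set k1 := jacsum _ _ _ _ _ _; set k2 := jacsum _ _ _ _ _ _; set k3 := jacsum _ _ _ _ _ _.
set l1 := jacsum _ _ _ _ _ _; set l2 := jacsum _ _ _ _ _ _; set l3 := jacsum _ _ _ _ _ _.
move=> A0 B0 J1 J0 J5.
transitivity ((A1 + A2 + A3) + (a - b) * (B1 + B2 + B3)
  + (a - b) ^+ 2 * (j1 + j2 + j3 + (b1 + b2 + b3))
  + (a - b) * (k1 + k2 + k3) + (a - b) ^+ 3 * (l1 + l2 + l3)); first by ring.
by rewrite A0 B0 J1 J0 J5 !mulr0 !addr0.
Qed.
End FamilyJacobi.

(** * Consequences of the PBW property *)

Section Necessity.
Variables (K : fieldType) (n : nat).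
Variables (kL : {perm 'I_n} -> 'I_n -> 'I_n -> 'I_n -> K)
          (kC : {perm 'I_n} -> 'I_n -> 'I_n -> K).
Implicit Types (f : elt K n) (g h s : {perm 'I_n}) (i j l x y : 'I_n).
Local Notation ideal := (in_ideal kL kC).
Local Notation kap := (kapply kL kC).

Lemma ideal_cat f f' : ideal f -> ideal f' -> ideal (f ++ f').
Proof.
move=> [s E] [s' E']; exists (s ++ s') => m.
by rewrite map_cat flatten_cat !coef_dirac !lin_cat -!coef_dirac E E'.
Qed.

Lemma ideal_scale a f : ideal f -> ideal (scale a f).
Proof.
move=> [s E]; exists [seq ((a * t.1.1, t.1.2), t.2) | t <- s] => m.
rewrite coef_dirac lin_scale -coef_dirac E !coef_dirac !lin_flatten big_map mulr_sumr.
by apply: eq_bigr => t _; rewrite !lin_scale mulrA.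
Qed.

Lemma ideal_relmon m1 i j m2 : ideal (relmon kL kC m1 i j m2).
Proof.
exists [:: ((1, m1), ((i, j), m2))] => m.
by rewrite !coef_dirac lin_flatten big_seq1 lin_scale mul1r.
Qed.

Lemma ideal_flatten (T : Type) (r : seq T) (F : T -> elt K n) :
  (forall t, ideal (F t)) -> ideal (flatten [seq F t | t <- r]).
Proof.
move=> IF; elim: r => [|x r IH] /=; last exact: ideal_cat.
by exists [::].
Qed.

Lemma coef_filter (P : pred (mon n)) f m :
  coef [seq p <- f | P p.2] m = if P m then coef f m else 0.
Proof.
rewrite /coef big_filter_cond; case: ifP => Pm; last first.
  by rewrite big1 // => p /andP[Pp /eqP E]; rewrite -E Pp in Pm.
by apply: eq_bigl => p; case: eqP => [->|]; rewrite ?andbT ?andbF.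
Qed.

Hypothesis doa : DOA kL kC.

(** [DOA] is applied to the part of degree [d], with minus the remaining part as the element of
    lower degree. *)
Lemma DOA_top d f : ideal f ->
  (forall m, (d < size m.1)%N -> coef f m = 0) ->
  (forall m, size m.1 = d -> coef f m != 0 -> sorted (@ileq n) m.1) ->
  forall m, size m.1 = d -> coef f m = 0.
Proof.
move=> [s E] hi srt m sm.
pose P (m : mon n) := size m.1 == d.
have -> : coef f m = coef [seq p <- f | P p.2] m by rewrite coef_filter /P sm eqxx.
apply: (doa (d := d)).
  move=> m'; rewrite coef_filter /P; case: (eqVneq (size m'.1) d) => [sm' nz|_]; last by rewrite eqxx.
  by split=> //; apply: srt.
exists (scale (-1) [seq p <- f | ~~ P p.2]); split=> [m' sm'|].
  rewrite coef_dirac lin_scale -coef_dirac (coef_filter (fun m => ~~ P m)) /P.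
  case: eqP => [_|ne]; rewrite ?mulr0 //= hi ?mulr0 //.
  by rewrite ltn_neqAle sm' andbT eq_sym; apply/eqP.
exists s => m'; rewrite -E /esub coef_dirac lin_cat !lin_scale mulrA mulrNN !mul1r.
rewrite -!coef_dirac coef_filter (coef_filter (fun m => ~~ P m)).
by case: (P m'); rewrite ?addr0 ?add0r.
Qed.

(** Words of length at most one are sorted, so [DOA_top] applies in degree 1 and then in degree
    0. *)
Lemma DOA_low f : ideal f -> (forall m, (1 < size m.1)%N -> coef f m = 0) ->
  forall m, coef f m = 0.
Proof.
move=> If hi.
have top1 m : size m.1 = 1%N -> coef f m = 0.
  by apply: (DOA_top If hi) => -[[|x [|]] g] //.
have top0 m : size m.1 = 0%N -> coef f m = 0.
  apply: (DOA_top If) => -[[|x [|y w]] g] // _; first exact: top1.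
  exact: hi.
by case=> -[|x [|y w]] g; [apply: top0 | apply: top1 | apply: hi].
Qed.

Definition q2 f x y g := coef f ([:: x; y], g).

(** The linear coefficient forced when the quadratic part [q] is reordered by the relations; it
    depends on [kL] but not on [kC]. *)
Definition lincorr (q : 'I_n -> 'I_n -> {perm 'I_n} -> K) x h : K :=
  - \sum_(u : 'I_n * 'I_n * {perm 'I_n} | (u.1.2 < u.1.1)%N)
     q u.1.1 u.1.2 u.2 * \sum_g kL g u.1.1 u.1.2 x * (u.2 * g == h)%g%:R.

Lemma DOA_quadratic f : ideal f -> (forall m, (2 < size m.1)%N -> coef f m = 0) ->
  (forall x y g, q2 f x y g + q2 f y x g = 0) /\
  (forall x g, coef f ([:: x], g) = lincorr (q2 f) x g).
Proof.
move=> If hi.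
(* Subtracting multiples of the relations at the descents leaves only ordered quadratic words in
   [f']. *)
pose us := [seq u : 'I_n * 'I_n * {perm 'I_n} <- enum {: 'I_n * 'I_n * {perm 'I_n}} | (u.1.2 < u.1.1)%N].
pose f' := f ++ flatten [seq scale (- q2 f u.1.1 u.1.2 u.2)
  (relmon kL kC ([::], 1%g) u.1.1 u.1.2 ([::], u.2)) | u <- us].
have If' : ideal f'.
  apply: ideal_cat => //; apply: ideal_flatten => u.
  by apply: ideal_scale; apply: ideal_relmon.
have linf' phi : lin phi f' = lin phi f -
    \sum_(u : 'I_n * 'I_n * {perm 'I_n} | (u.1.2 < u.1.1)%N)
      q2 f u.1.1 u.1.2 u.2 * (phi [:: u.1.1; u.1.2] u.2 - phi [:: u.1.2; u.1.1] u.2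
         - kap u.1.1 u.1.2 (fun w h => phi w (u.2 * h)%g)).
  rewrite lin_cat lin_flatten; congr (_ + _).
  rewrite /us big_filter big_enum_cond -sumrN; apply: eq_bigr => u _.
  rewrite lin_scale lin_relmon /= mulNr !mulg1 !perm1; congr (- (_ * (_ - _))).
  by apply: eq_kapply => w h _; rewrite cats0 mulg1 (eq_map (@perm1 _)) map_id.
have kap0 i j (m : mon n) (g : {perm 'I_n}) : (1 < size m.1)%N ->
    kap i j (fun w h => dirac K m w (g * h)%g) = 0.
  move=> sm; rewrite -(kapply0 kL kC i j); apply: eq_kapply => w h sw.
  by rewrite /dirac; case: eqP => // E; move: sm; rewrite -E /= ltnNge sw.
have hi' m : (2 < size m.1)%N -> coef f' m = 0.
  move=> sm; rewrite coef_dirac linf' -coef_dirac hi // big1 ?subr0 // => u _.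
  rewrite kap0 ?(ltnW sm) // /dirac.
  have D w : size w = 2%N -> ((w, u.2) == m) = false.
    by move=> sw; apply/eqP => E; move: sm; rewrite -E /= sw.
  by rewrite !D // !subr0 mulr0.
have c2 x y g : coef f' ([:: x; y], g) =
    q2 f x y g - (y < x)%N%:R * q2 f x y g + (x < y)%N%:R * q2 f y x g.
  rewrite coef_dirac linf' -coef_dirac -/(q2 f x y g) -addrA; congr (_ + _).
  rewrite (eq_bigr (fun u => q2 f u.1.1 u.1.2 u.2 * (u == (x, y, g))%:R
      - q2 f u.1.1 u.1.2 u.2 * (u == (y, x, g))%:R)) => [|[[u v] h] _] /=; last first.
    rewrite kap0 // subr0 -mulrBr /dirac !xpair_eqE !eqseq_cons !eqxx !andbT.
    by rewrite [(v == x) && _]andbC.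
  have pick (p q : 'I_n) : \sum_(u : 'I_n * 'I_n * {perm 'I_n} | (u.1.2 < u.1.1)%N)
      q2 f u.1.1 u.1.2 u.2 * (u == (p, q, g))%:R = (q < p)%N%:R * q2 f p q g.
    rewrite big_mkcond (bigD1 (p, q, g)) //= eqxx mulr1 big1 => [|u /negbTE->].
      by rewrite addr0; case: ifP; rewrite ?mul1r ?mul0r.
    by rewrite mulr0; case: ifP.
  by rewrite sumrB !pick opprB addrC.
have top2 := DOA_top If' hi'.
have q0 x y g : coef f' ([:: x; y], g) = 0.
  apply: top2 => // -[[|u [|v [|]]] h] // _ nz; rewrite /= andbT /ileq leqNgt.
  apply: contra nz => vu; rewrite c2 vu mul1r subrr add0r ltnNge (ltnW vu) mul0r //.
split=> [x y g|x g].
  have := q0 x y g; have := q0 y x g; rewrite !c2.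
  case: (ltngtP x y) => xy; rewrite ?mul1r ?mul0r ?subr0 ?addr0.
  - by rewrite addrC => _ ->.
  - by rewrite addrC => -> _.
  by move=> -> ->; rewrite addr0.
have low m : coef f' m = 0.
  apply: DOA_low If' _ m => -[[|u [|v [|w r]]] h] // _; exact: hi'.
have := low ([:: x], g); rewrite coef_dirac linf' -coef_dirac => /eqP.
rewrite subr_eq0 => /eqP->; rewrite /lincorr -sumrN; apply: eq_bigr => -[[u v] h] _ /=.
rewrite {1 2}/dirac !xpair_eqE !eqseq_cons !andbF /= subr0 sub0r mulrN; congr (- (_ * _)).
rewrite /kapply /dirac; apply: eq_bigr => h' _.
rewrite (bigD1 x) //= xpair_eqE eqxx /= big1 ?addr0 => [|y yx]; last first.
  by rewrite xpair_eqE eqseq_cons (negbTE yx) mulr0.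
by rewrite mulr0 addr0.
Qed.

Lemma kapply_dirac1 i j x g : kap i j (dirac K ([:: x], g)) = kL g i j x.
Proof.
rewrite /kapply (bigD1 g) //= [X in _ + X]big1 ?addr0 => [|h hg]; last first.
  rewrite /dirac xpair_eqE (negbTE hg) andbF mulr0 addr0 big1 // => l _.
  by rewrite xpair_eqE (negbTE hg) andbF mulr0.
rewrite (bigD1 x) //= /dirac eqxx mulr1 big1 ?addr0 ?mulr0 ?addr0 // => l lx.
by rewrite xpair_eqE eqseq_cons (negbTE lx) mulr0.
Qed.

Lemma kapply_dirac0 i j g : kap i j (dirac K ([::], g)) = kC g i j.
Proof.
rewrite /kapply (bigD1 g) //= [X in _ + X]big1 ?addr0 => [|h hg]; last first.
  rewrite /dirac xpair_eqE (negbTE hg) andbF mulr0 addr0 big1 // => l _.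
  by rewrite mulr0.
by rewrite /dirac eqxx mulr1 big1 ?add0r // => l _; rewrite mulr0.
Qed.

Lemma DOA_invariant : invariantL kL /\ invariantC kC.
Proof.
have main (s : {perm 'I_n}) i j (m : mon n) : kap (s i) (s j) (dirac K m) =
    kap i j (fun w h => dirac K m (map s w) (h ^ s)%g).
  (* The relation conjugated by [s] minus the relation of the images: the quadratic words cancel,
     and [DOA_low] makes the rest zero. *)
  pose f := relmon kL kC ([::], s) i j ([::], s^-1%g)
    ++ scale (-1) (relmon kL kC ([::], 1%g) (s i) (s j) ([::], 1%g)).
  have If : ideal f.
    by apply: ideal_cat; last apply: ideal_scale; apply: ideal_relmon.
  have linf phi : lin phi f = kap (s i) (s j) phi -
      kap i j (fun w h => phi (map s w) (h ^ s)%g).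
    rewrite lin_cat lin_scale !lin_relmon /= !mulg1 mulVg !perm1.
    set a1 := kap _ _ _; set a2 := kap _ _ _; set a3 := kap _ _ _; set a4 := kap _ _ _.
    have -> : a1 = a4 by apply: eq_kapply => w h _; rewrite cats0 conjgE mulgA.
    have -> : a2 = a3; last by ring.
    apply: eq_kapply => w h _.
    by rewrite cats0 mulg1 mul1g (eq_map (@perm1 _)) map_id.
  apply/eqP; rewrite -subr_eq0 -linf -coef_dirac; apply/eqP/DOA_low => // m' sm'.
  have Z (w : seq 'I_n) h : (size w <= 1)%N -> dirac K m' w h = 0.
    by rewrite /dirac => sw; case: eqP => // E; move: sm'; rewrite -E ltnNge sw.
  rewrite coef_dirac linf (eq_kapply _ _ _ _ Z) kapply0 sub0r.
  have Z' (w : seq 'I_n) h : (size w <= 1)%N -> dirac K m' (map s w) (h ^ s)%g = 0.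
    by move=> sw; rewrite Z ?size_map.
  by rewrite (eq_kapply _ _ _ _ Z') kapply0 oppr0.
split=> s g i j; first move=> l; have := main s i j.
  move/(_ ([:: s l], (g ^ s)%g)); rewrite kapply_dirac1 => ->.
  rewrite -kapply_dirac1; apply: eq_kapply => w h _.
  rewrite /dirac !xpair_eqE (inj_eq (conjg_inj s)) -[[:: s l]]/(map s [:: l]).
  by rewrite (inj_eq (inj_map (@perm_inj _ s))).
move/(_ ([::], (g ^ s)%g)); rewrite kapply_dirac0 => ->.
rewrite -kapply_dirac0; apply: eq_kapply => w h _.
rewrite /dirac !xpair_eqE (inj_eq (conjg_inj s)) -[[::] in LHS]/(map s [::]).
by rewrite (inj_eq (inj_map (@perm_inj _ s))).
Qed.

(** Cyclic sum of the commutators of a relation with e_l. Its cubic words cancel by the Jacobi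
    identity of T(V), which leaves minus the Jacobi element of kappa. *)
Definition jacelt i j l : elt K n :=
  let e i j l := relmon kL kC ([::], 1%g) i j ([:: l], 1%g)
    ++ scale (-1) (relmon kL kC ([:: l], 1%g) i j ([::], 1%g)) in
  e i j l ++ e j l i ++ e l i j.

Lemma ideal_jacelt i j l : ideal (jacelt i j l).
Proof.
have H i' j' l' : ideal (relmon kL kC ([::], 1%g) i' j' ([:: l'], 1%g)
    ++ scale (-1) (relmon kL kC ([:: l'], 1%g) i' j' ([::], 1%g))).
  by apply: ideal_cat; last apply: ideal_scale; apply: ideal_relmon.
by apply: ideal_cat => //; apply: ideal_cat.
Qed.

Lemma lin_jacelt phi i j l :
  let J i j l := kap i j (fun w h => phi (rcons w (h l)) h - phi (l :: w) h) in
  lin phi (jacelt i j l) = - (J i j l + J j l i + J l i j).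
Proof.
have H i' j' l' : lin phi (relmon kL kC ([::], 1%g) i' j' ([:: l'], 1%g)
    ++ scale (-1) (relmon kL kC ([:: l'], 1%g) i' j' ([::], 1%g))) =
  phi [:: i'; j'; l'] 1%g - phi [:: j'; i'; l'] 1%g
  - phi [:: l'; i'; j'] 1%g + phi [:: l'; j'; i'] 1%g
  - kap i' j' (fun w h => phi (rcons w (h l')) h - phi (l' :: w) h).
  rewrite lin_cat lin_scale !lin_relmon /= !mulg1 !perm1 kapplyB.
  set a1 := kap _ _ _; set a2 := kap _ _ _; set a3 := kap _ _ _; set a4 := kap _ _ _.
  have -> : a1 = a3.
    apply: eq_kapply => w h _.
    by rewrite mul1g mulg1 (eq_map (@perm1 _)) map_id cats1.
  have -> : a2 = a4; last by ring.
  apply: eq_kapply => w h _.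
  by rewrite mul1g mulg1 (eq_map (@perm1 _)) map_id cats0.
by rewrite /jacelt lin_cat [X in _ + X]lin_cat !H /=; ring.
Qed.

(** [DOA_quadratic] applied to [jacelt]: the symmetrised quadratic coefficients vanish, and the
    linear ones equal a correction depending only on [kL]. *)
Lemma DOA_jacobi :
  (forall g i j l x y,
    let S i j l := kL g i j x * ((g l == y)%:R - (l == y)%:R)
                 + kL g i j y * ((g l == x)%:R - (l == x)%:R) in
    S i j l + S j l i + S l i j = 0) /\
  (forall g i j l x,
    let S i j l := kC g i j * ((g l == x)%:R - (l == x)%:R) in
    let Q i j l x y g := kL g i j x * (g l == y)%:R - kL g i j y * (l == x)%:R in
    S i j l + S j l i + S l i j =
    - lincorr (fun x y g => - (Q i j l x y g + Q j l i x y g + Q l i j x y g)) x g).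
Proof.
have kap2 i j l x y g : kap i j (fun w h => dirac K ([:: x; y], g) (rcons w (h l)) h
      - dirac K ([:: x; y], g) (l :: w) h) = kL g i j x * (g l == y)%:R - kL g i j y * (l == x)%:R.
  rewrite kapplyB; congr (_ - _).
    rewrite -kapply_dirac1 mulrC -kapplyZ; apply: eq_kapply => w h sw.
    rewrite /dirac !xpair_eqE -[[:: x; y]]/(rcons [:: x] y) eqseq_rcons -natrM mulnb.
    by case: (h =P g) => [->|_]; rewrite ?andbF // !andbT andbC.
  rewrite -kapply_dirac1 mulrC -kapplyZ; apply: eq_kapply => w h sw.
  by rewrite /dirac !xpair_eqE eqseq_cons -natrM mulnb andbA.
have kap1 i j l x g : kap i j (fun w h => dirac K ([:: x], g) (rcons w (h l)) h
      - dirac K ([:: x], g) (l :: w) h) = kC g i j * ((g l == x)%:R - (l == x)%:R).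
  rewrite kapplyB mulrBr; congr (_ - _).
    rewrite -kapply_dirac0 mulrC -kapplyZ; apply: eq_kapply => w h sw.
    rewrite /dirac !xpair_eqE -[[:: x]]/(rcons [::] x) eqseq_rcons -natrM mulnb.
    by case: (h =P g) => [->|_]; rewrite ?andbF // !andbT andbC.
  rewrite -kapply_dirac0 mulrC -kapplyZ; apply: eq_kapply => w h sw.
  by rewrite /dirac !xpair_eqE eqseq_cons -natrM mulnb andbA.
have hi i j l m : (2 < size m.1)%N -> coef (jacelt i j l) m = 0.
  move=> sm; rewrite coef_dirac lin_jacelt.
  have Z i' j' l' : kap i' j' (fun w h => dirac K m (rcons w (h l')) h - dirac K m (l' :: w) h) = 0.
    rewrite -(kapply0 kL kC i' j'); apply: eq_kapply => w h sw.
    rewrite /dirac; case: eqP => [E|_].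
      by move: sm; rewrite -E /= size_rcons ltnNge ltnS sw.
    case: eqP => [E|_]; last by rewrite subrr.
    by move: sm; rewrite -E /= ltnNge ltnS sw.
  by rewrite !Z !addr0 oppr0.
split=> [g i j l x y S|g i j l x S Q].
  have [q0 _] := DOA_quadratic (ideal_jacelt i j l) (@hi i j l).
  have := q0 x y g; rewrite /q2 !coef_dirac !lin_jacelt !kap2 => E.
  by rewrite -[RHS]oppr0 -[in RHS]E /S; ring.
have [_ lin1] := DOA_quadratic (ideal_jacelt i j l) (@hi i j l).
have := lin1 x g; rewrite coef_dirac lin_jacelt !kap1 => /(congr1 -%R); rewrite opprK => ->.
rewrite /lincorr !opprK; apply: eq_bigr => u _; congr (_ * _).
by rewrite /q2 coef_dirac lin_jacelt !kap2.
Qed.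
End Necessity.

(** * Classification of the cochains *)

Section Classification.
Variables (K : numFieldType) (n : nat).
Implicit Types (g h s : {perm 'I_n}) (i j k l m x y : 'I_n).

Definition cocycle g (beta : 'I_n -> 'I_n -> K) := forall i j l x,
  beta i j * ((g l == x)%:R - (l == x)%:R) + beta j l * ((g i == x)%:R - (i == x)%:R)
  + beta l i * ((g j == x)%:R - (j == x)%:R) = 0.

Lemma cocycle_support g (beta : 'I_n -> 'I_n -> K) i j :
  (forall x y, beta y x = - beta x y) -> cocycle g beta ->
  (forall x, g (g x) = x -> forall y z,
     beta (tperm x (g x) y) (tperm x (g x) z) = beta y z) ->
  g != 1%g -> beta i j != 0 ->
  exists k, is_cyc3 i j k g || is_cyc3 k j i g.
Proof.
move=> alt coc inv g1.
have eq0 (t : K) : t = - t -> t = 0.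
  by move/eqP; rewrite -addr_eq0 -mulr2n mulrn_eq0 => /eqP.
have ginj := @perm_inj _ g.
have ne x y : beta x y != 0 -> x != y.
  by apply: contraNneq => ->; apply/eqP/eq0.
(* Suppose [g y = y]. If also [g x = x], every point is fixed. Otherwise the triple [x], [y], [g x]
   shows that [g] swaps [x] and [g x], and invariance under this transposition makes [beta x y] its
   own negative. *)
have moved x y : beta x y != 0 -> g y != y.
  move=> bxy; have xy := ne _ _ bxy; apply/negP => /eqP gy.
  have gx : g x != x.
    apply/eqP => gx; case/eqP: g1; apply/permP => l; rewrite perm1; apply/eqP.
    have := coc x y l l; rewrite gx gy !subrr !mulr0 !addr0 eqxx => /eqP.
    by rewrite mulf_eq0 (negbTE bxy) /= subr_eq0; case: (g l == l); rewrite // eq_sym oner_eq0.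
  have ly : g x != y by rewrite -[X in _ == X]gy (inj_eq ginj).
  have := coc x y (g x) (g x); rewrite gy subrr mulr0 addr0 eqxx (inj_eq ginj) (negbTE gx).
  rewrite eq_sym (negbTE gx) subr0 mulr1 sub0r mulrN1 => /eqP.
  rewrite addrC subr_eq0 => /eqP E1.
  have := coc x y (g x) x; rewrite gy subrr mulr0 addr0 eqxx (negbTE gx) subr0 sub0r.
  rewrite mulrN1 E1 -[X in _ - X]mulr1 -mulrBr => /eqP; rewrite mulf_eq0 (negbTE bxy) /= subr_eq0.
  case: (eqVneq (g (g x)) x) => [ggx _|_]; last by rewrite eq_sym oner_eq0.
  have := inv x ggx x y; rewrite tpermL tpermD // 1?eq_sym // => E2.
  by move: bxy; rewrite (eq0 (beta x y)) ?eqxx // -{1}E2 alt E1.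
(* Coordinates [y], [k], [x] of the triple [x], [y], [k] make the three values of [beta] equal and
   give [g k = x]; every further [l] is fixed by coordinate [l] of the triple [x], [y], [l]. *)
have case2 x y : beta x y != 0 -> g x = y -> g y != x -> is_cyc3 x y (g y) g.
  move=> bxy gx gyx; have xy := ne _ _ bxy; have gyy := moved _ _ bxy.
  set k := g y in gyx gyy *.
  have gkk : g k != k by rewrite /k (inj_eq ginj) gyy.
  have gky : g k != y by rewrite -[y]gx (inj_eq ginj).
  have := coc x y k y; rewrite gx -/k eqxx (negbTE gky) (negbTE gyy) (negbTE xy).
  rewrite subrr mulr0 add0r subr0 sub0r mulr1 mulrN1 => /eqP; rewrite subr_eq0 => /eqP E1.
  have := coc x y k k; rewrite gx -/k eqxx (negbTE gkk) [y == k]eq_sym (negbTE gyy).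
  rewrite [x == k]eq_sym (negbTE gyx) subrr mulr0 addr0 sub0r subr0 mulr1 mulrN1 => /eqP.
  rewrite addrC subr_eq0 => /eqP E2.
  have := coc x y k x; rewrite gx -/k eqxx (negbTE gyx) [y == x]eq_sym (negbTE xy).
  rewrite subrr mulr0 addr0 subr0 sub0r mulrN1 E1 E2 -[X in _ - X]mulr1 -mulrBr => /eqP.
  rewrite mulf_eq0 (negbTE bxy) /= subr_eq0.
  case: (eqVneq (g k) x) => [gk _|_]; last by rewrite eq_sym oner_eq0.
  apply/and4P; split; rewrite ?gx ?gk //; apply/forallP => l; apply/implyP.
  rewrite !inE !negb_or => /and3P[lx ly lk].
  have := coc x y l l; rewrite gx -/k eqxx ![_ == l]eq_sym (negbTE lx) (negbTE ly) (negbTE lk).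
  rewrite !subrr !mulr0 !addr0 => /eqP.
  rewrite mulf_eq0 (negbTE bxy) /= subr_eq0 [l == _]eq_sym.
  by case: (g l == l); rewrite // eq_sym oner_eq0.
move=> bij; have ij := ne _ _ bij; have gj := moved _ _ bij.
have bji : beta j i != 0 by rewrite alt oppr_eq0.
have gi := moved _ _ bji.
have [gij|gij] := eqVneq (g i) j.
  have [gji|gji] := eqVneq (g j) i; last by exists (g j); rewrite case2.
  have ggi : g (g i) = i by rewrite gij.
  have := inv i ggi i j; rewrite gij tpermL tpermR alt => /esym/eq0 E.
  by rewrite E eqxx in bij.
have [gji|gji] := eqVneq (g j) i.
  exists (g i); rewrite [is_cyc3 (g i) j i g]is_cyc3_rot case2 ?orbT //.
(* Here [g] sends neither point to the other. Coordinates [g j], [p], [i] give in turn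
   [beta p i = 0], [beta j p = beta i j] and [g p = i]; the transposition of [i] and [p] then
   contradicts [beta i j != 0]. *)
set p := g i in gi gij.
have gpp : g p != p by rewrite /p (inj_eq ginj).
have pgj : p != g j by rewrite /p (inj_eq ginj).
have gpj : g p != g j by rewrite (inj_eq ginj).
have := coc i j p (g j); rewrite -/p eqxx (negbTE gpj) (negbTE pgj) !subrr.
rewrite [i == _]eq_sym (negbTE gji) subrr !mulr0 !add0r [j == _]eq_sym (negbTE gj) subr0 mulr1 => E0.
have := coc i j p p; rewrite -/p E0 mul0r addr0 eqxx (negbTE gpp) [i == p]eq_sym (negbTE gi).
rewrite subr0 sub0r mulr1 mulrN1 addrC => /eqP; rewrite subr_eq0 => /eqP E1.
have := coc i j p i; rewrite -/p E0 mul0r addr0 eqxx (negbTE gi) E1 subr0 sub0r.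
rewrite -mulrDr => /eqP; rewrite mulf_eq0 (negbTE bij) /= subr_eq0.
case: (eqVneq (g p) i) => [gp _|_]; last by rewrite eq_sym oner_eq0.
have := inv i gp i j; rewrite -/p tpermL tpermD // 1?eq_sym // alt E1 => /esym/eq0 E.
by rewrite E eqxx in bij.
Qed.

Lemma exists_perm_map (T : finType) (r t : seq T) : uniq r -> uniq t -> size r = size t ->
  exists s : {perm T}, map s r = t.
Proof.
elim: r t => [|x r IH] [|y t] //=; first by exists 1%g.
move=> /andP[xr Ur] /andP[yt Ut] [sz]; have [s E] := IH t Ur Ut sz.
exists (s * tperm (s x) y)%g; rewrite permM tpermL; congr (_ :: _).
rewrite -E; apply/eq_in_map => z zr; rewrite permM tpermD //.
  by apply: contraNneq xr => /perm_inj->.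
by apply: contraNneq yt => ->; rewrite -E map_f.
Qed.

Lemma is_cyc3_uniq i j k g : i != j -> is_cyc3 i j k g -> uniq [:: i; j; k].
Proof.
move=> ij /and4P[/eqP gi /eqP gj /eqP gk _]; rewrite /= !inE negb_or ij andbT /=.
apply/andP; split; apply/eqP => E.
  by move: ij; rewrite -gi -{1}gk E eqxx.
by move: ij; rewrite -(inj_eq (@perm_inj _ g)) gi gj E eqxx.
Qed.

Lemma kappaL_cyc3 (a b : K) i j k m : uniq [:: i; j; k] ->
  kappaL a b (cyc [:: i; j; k]) i j m = if m \in [:: i; j; k] then a else b.
Proof.
move=> U; have := U; rewrite /= !inE negb_or => /and3P[/andP[ij ik] jk _].
have c3 : is_cyc3 i j k (cyc [:: i; j; k]) by rewrite is_cyc3E.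
have /and4P[_ /eqP gj _ _] := c3.
have F k' : is_cyc3 k' j i (cyc [:: i; j; k]) = false.
  by apply/negP => /and4P[_ /eqP + _ _]; rewrite gj => E; rewrite E eqxx in ik.
rewrite /kappaL (negbTE ij) (bigD1 k) /=; last by rewrite eq_sym ik eq_sym jk.
rewrite c3 F subr0 mul1r big1 ?addr0 ?inE // => k' /andP[_ kk].
rewrite F subr0; case c3' : is_cyc3; rewrite ?mul0r //.
by move: c3' kk => /and4P[_ /eqP + _ _]; rewrite gj => ->; rewrite eqxx.
Qed.

Lemma kappaL_support (a b : K) g i j m :
  (forall k, ~~ (is_cyc3 i j k g || is_cyc3 k j i g)) -> kappaL a b g i j m = 0.
Proof.
move=> H; rewrite /kappaL; case: eqP => // _; rewrite big1 // => k _.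
by have := H k; rewrite negb_or => /andP[/negbTE-> /negbTE->]; rewrite subrr mul0r.
Qed.

(** The [c]-part has the shape of a coordinate of [kappaL] with both weights 1, so the facts on
    [kappaL] serve for it too. *)
Lemma kappaCE (a b c : K) g i j m :
  kappaC a b c g i j = kappaC a b 0 g i j + c * kappaL 1 1 g i j m.
Proof.
rewrite /kappaC /kappaL; case: eqP => _; first by rewrite mulr0 addr0.
rewrite mul0r add0r addrC; congr (_ + c * _).
by apply: eq_bigr => k _; rewrite if_same mulr1.
Qed.

Lemma cyc3_ext (beta beta' : {perm 'I_n} -> 'I_n -> 'I_n -> K) :
  alternatingC beta -> alternatingC beta' ->
  (forall i j k, uniq [:: i; j; k] ->
     beta (cyc [:: i; j; k]) i j = beta' (cyc [:: i; j; k]) i j) ->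
  (forall g i j, (forall k, ~~ (is_cyc3 i j k g || is_cyc3 k j i g)) ->
     beta g i j = beta' g i j) ->
  forall g i j, beta g i j = beta' g i j.
Proof.
move=> alt alt' H S g i j.
have [->|ij] := eqVneq i j; first by rewrite (alt g j j).1 (alt' g j j).1.
have pos x y k : x != y -> is_cyc3 x y k g -> beta g x y = beta' g x y.
  move=> xy c3; have U := is_cyc3_uniq xy c3.
  by move: c3; rewrite is_cyc3E // => /eqP->; rewrite H.
case: (boolP [exists k, is_cyc3 i j k g || is_cyc3 k j i g]) => [/existsP[k /orP[]]|].
- exact: pos.
- rewrite is_cyc3_rot => c3; rewrite (alt g j i).2 (alt' g j i).2.
  by rewrite (pos _ _ k) // eq_sym.
by rewrite negb_exists => /forallP/S.
Qed.

Lemma conj_tperm g x : g (g x) = x -> (g ^ tperm x (g x) = g)%g.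
Proof.
move=> ggx; apply/conjg_fixP/commgP; apply: commute_sym.
by apply/commgP/conjg_fixP; rewrite tpermJ ggx tpermC.
Qed.

Section Solve.
Variables (kL : {perm 'I_n} -> 'I_n -> 'I_n -> 'I_n -> K)
          (kC : {perm 'I_n} -> 'I_n -> 'I_n -> K).
Hypotheses (altL : alternatingL kL) (doa : DOA kL kC).
Hypothesis fixL : forall g i j l, kL g i j (g l) = kL g i j l.

Lemma fixL_porbit g i j x m : x \in porbit g m -> kL g i j x = kL g i j m.
Proof.
case/porbitP=> k ->; elim: k => [|k IH]; first by rewrite expg0 perm1.
by rewrite expgSr permM fixL.
Qed.

(* Summing the symmetric condition over the [g]-orbit of [m] kills one of its
   two halves, because the image of [kL g] is fixed by [g]. *)
Lemma cocycleL g m : cocycle g (fun i j => kL g i j m).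
Proof.
move=> i j l y; have [H _] := DOA_jacobi doa.
pose O := porbit g m; pose d l y : K := (g l == y)%:R - (l == y)%:R.
have d0 l' : \sum_(x in O) d l' x = 0.
  rewrite sumrB; have S z : \sum_(x in O) (z == x)%:R = (z \in O)%:R :> K.
    rewrite big_mkcond (bigD1 z) //= eqxx big1 ?addr0; first by case: (z \in O).
    by move=> x /negbTE; rewrite eq_sym => ->; case: ifP.
  rewrite !S /O -!eq_porbit_mem; suff -> : porbit g (g l') = porbit g l' by rewrite subrr.
  by have := porbit_perm g 1 l'; rewrite expg1.
have half i' j' l' : \sum_(x in O) (kL g i' j' x * d l' y + kL g i' j' y * d l' x) =
    #|O|%:R * (kL g i' j' m * d l' y).
  rewrite big_split /= -mulr_sumr d0 mulr0 addr0.
  rewrite (eq_bigr (fun=> kL g i' j' m * d l' y)) => [|x xO]; last by rewrite (fixL_porbit _ _ xO).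
  by rewrite sumr_const mulr_natl.
have : \sum_(x in O) ((kL g i j x * d l y + kL g i j y * d l x)
    + (kL g j l x * d i y + kL g j l y * d i x)
    + (kL g l i x * d j y + kL g l i y * d j x)) = 0.
  by apply: big1 => x _; apply: H.
move=> E; rewrite 2!big_split /= !half -!mulrDr in E; move/eqP: E.
rewrite mulf_eq0 pnatr_eq0 => /orP[|/eqP //].
by rewrite -[_ == _]negbK card_porbit_neq0.
Qed.

Let invL : invariantL kL := (DOA_invariant doa).1.

(** The transposition commutes with [g]; its effect on the coordinate [m] is undone by [fixL], as it
    exchanges two points of one [g]-orbit. *)
Lemma tperm_invL g m x : g (g x) = x -> forall y z,
  kL g (tperm x (g x) y) (tperm x (g x) z) m = kL g y z m.
Proof.
move=> ggx y z; set t := tperm x (g x).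
have fixt l : kL g y z (t l) = kL g y z l.
  by rewrite /t; case: tpermP => [->|->|//]; rewrite ?fixL // -(fixL _ _ _ (g x)) ggx.
by rewrite -{1}[m](tpermK x (g x)) -{1}(conj_tperm ggx) invL fixt.
Qed.

Hypothesis (offL : forall i j l, kL 1%g i j l = 0).

Lemma supportL g i j m :
  (forall k, ~~ (is_cyc3 i j k g || is_cyc3 k j i g)) -> kL g i j m = 0.
Proof.
move=> H; have [->|g1] := eqVneq g 1%g; first exact: offL.
apply/eqP/negPn/negP => nz.
have alt x y : kL g y x m = - kL g x y m := (altL g x y m).2.
have [k] := cocycle_support alt (@cocycleL g m) (@tperm_invL g m) g1 nz.
by rewrite (negbTE (H k)).
Qed.

Lemma cyc3_transport i j k i' j' k' (r r' : seq 'I_n) :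
  uniq [:: i, j, k & r] -> uniq [:: i', j', k' & r'] -> size r = size r' ->
  exists s : {perm 'I_n}, [/\ s i = i', s j = j', map s r = r' &
    (cyc [:: i; j; k] ^ s)%g = cyc [:: i'; j'; k']].
Proof.
move=> U U' sz; have [|s [si sj sk sr]] := exists_perm_map U U'; first by rewrite /= sz.
exists s; split=> //; rewrite cyc_conj /= ?si ?sj ?sk //.
by have := U; rewrite -[_ :: _]/([:: i; j; k] ++ r) cat_uniq => /andP[].
Qed.

Lemma solveL : (3 <= n)%N -> exists a b : K, forall g i j m,
  kL g i j m = kappaL a b g i j m.
Proof.
move=> n3; pose o (k : nat) (kn : (k < 3)%N) : 'I_n := Ordinal (leq_trans kn n3).
pose i0 := o 0%N isT; pose i1 := o 1%N isT; pose i2 := o 2%N isT.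
have U0 : uniq [:: i0; i1; i2] by [].
pose g0 := cyc [:: i0; i1; i2].
(* The parameters are read off at one reference 3-cycle, on and off its points; for [n = 3] no point
   lies off it and [b] defaults to 0. *)
pose a := kL g0 i0 i1 i0.
pose b := if [pick m | m \notin [:: i0; i1; i2]] is Some m then kL g0 i0 i1 m else 0.
exists a, b => g i j m; move: g i j; apply: cyc3_ext.
- by move=> g i j; apply: altL.
- by move=> g i j; apply: family_alternatingL.
- move=> i j k U; rewrite kappaL_cyc3 //; case: ifPn => mU.
    have -> : kL (cyc [:: i; j; k]) i j m = kL (cyc [:: i; j; k]) i j i.
      have /and4P[/eqP gi /eqP gj _ _] : is_cyc3 i j k (cyc [:: i; j; k]) by rewrite is_cyc3E.
      move: mU; rewrite !inE => /or3P[]/eqP-> //.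
        by rewrite -(fixL _ i j i) gi.
      by rewrite -(fixL _ i j i) gi -(fixL _ i j j) gj.
    have [s [si sj _ gs]] := cyc3_transport (r := [::]) (r' := [::]) U0 U erefl.
    by rewrite -gs -si -sj invL.
  have Um : uniq [:: i, j, k & [:: m]].
    by rewrite -[X in uniq X]/(rcons [:: i; j; k] m) rcons_uniq mU.
  rewrite /b; case: pickP => [m0 m0U|none]; last first.
    have /(uniq_leq_size Um) // : {subset [:: i; j; k; m] <= [:: i0; i1; i2]}.
    by move=> z _; rewrite -[_ \in _]negbK none.
  have Um0 : uniq [:: i0, i1, i2 & [:: m0]].
    by rewrite -[X in uniq X]/(rcons [:: i0; i1; i2] m0) rcons_uniq m0U.
  have [s [si sj [sm] gs]] := cyc3_transport Um0 Um erefl.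
  by rewrite -gs -si -sj -sm invL.
by move=> g i j H; rewrite supportL // kappaL_support.
Qed.
End Solve.

(** Both algebras have the same [kL], hence the same linear corrections; the difference [D] of the
    constant parts therefore satisfies the homogeneous equation [cocycle], and [c] is its value at a
    reference 3-cycle. *)
Lemma solveC (a b : K) (kC : {perm 'I_n} -> 'I_n -> 'I_n -> K) : (3 <= n)%N ->
  alternatingC kC -> DOA (@kappaL K n a b) kC -> DOA (@kappaL K n a b) (@kappaC K n a b 0) ->
  exists c : K, forall g i j, kC g i j = kappaC a b c g i j.
Proof.
move=> n3 altC doa doa0; pose o (k : nat) (kn : (k < 3)%N) : 'I_n := Ordinal (leq_trans kn n3).
pose i0 := o 0%N isT; pose i1 := o 1%N isT; pose i2 := o 2%N isT.
have U0 : uniq [:: i0; i1; i2] by [].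
pose g0 := cyc [:: i0; i1; i2].
pose D g i j := kC g i j - kappaC a b 0 g i j.
have altD : alternatingC D.
  move=> g i j; rewrite /D (altC g i i).1 (family_alternatingC a b 0 g i i).1 subrr; split=> //.
  by rewrite (altC g i j).2 (family_alternatingC a b 0 g i j).2 opprB opprK addrC.
have invD : invariantC D.
  move=> s g i j; rewrite /D (DOA_invariant doa).2.
  by rewrite (DOA_invariant doa0).2.
have cocD g : cocycle g (D g).
  move=> i j l x; have := (DOA_jacobi doa).2 g i j l x; have := (DOA_jacobi doa0).2 g i j l x.
  by move=> /= <- /eqP; rewrite -subr_eq0 => /eqP E; rewrite -[RHS]E /D; ring.
have suppD g i j : (forall k, ~~ (is_cyc3 i j k g || is_cyc3 k j i g)) -> D g i j = 0.
  move=> H; have [->|g1] := eqVneq g 1%g.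
    (* At the identity, invariance under the transposition of [i] and [j] contradicts alternation
       unless the value is 0. *)
    have := invD (tperm i j) 1%g i j; rewrite conj1g tpermL tpermR (altD 1%g i j).2 => /eqP.
    by rewrite eq_sym -addr_eq0 -mulr2n mulrn_eq0 => /eqP.
  apply/eqP/negPn/negP => nz.
  have alt x y : D g y x = - D g x y := (altD g x y).2.
  have inv x : g (g x) = x -> forall y z,
      D g (tperm x (g x) y) (tperm x (g x) z) = D g y z.
    by move=> ggx y z; rewrite -{1}(conj_tperm ggx) invD.
  have [k] := cocycle_support alt (cocD g) inv g1 nz.
  by rewrite (negbTE (H k)).
exists (D g0 i0 i1) => g i j; rewrite (kappaCE _ _ _ _ _ _ i0) -[LHS](subrK (kappaC a b 0 g i j)).
rewrite addrC -/(D g i j); congr (_ + _); move: g i j.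
apply: (cyc3_ext (beta' := fun g i j => D g0 i0 i1 * kappaL 1 1 g i j i0)) => //.
- move=> g i j; rewrite (family_alternatingL 1 1 g i i i0).1 mulr0; split=> //.
  by rewrite (family_alternatingL 1 1 g i j i0).2 mulrN.
- move=> i j k U; rewrite kappaL_cyc3 // if_same mulr1.
  have [s [si sj _ gs]] := cyc3_transport (r := [::]) (r' := [::]) U0 U erefl.
  by rewrite -gs -si -sj invD.
by move=> g i j H; rewrite suppD // kappaL_support // mulr0.
Qed.

Lemma family_DOA (a b c : K) : (3 <= n)%N -> DOA (@kappaL K n a b) (@kappaC K n a b c).
Proof.
move=> n3; apply: jacobi_DOA.
- exact: family_alternatingL.
- exact: family_alternatingC.
- exact: family_invariantL.
- exact: family_invariantC.
exact: (@family_jacobi _ _ _ _ _ (Ordinal (leq_trans (isT : 0 < 3)%N n3))).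
Qed.

Lemma kappaL_fixed (a b : K) g i j l : kappaL a b g i j (g l) = kappaL a b g i j l.
Proof.
rewrite /kappaL; case: eqP => // /eqP ij; apply: eq_bigr => k _.
have step x y : g x = y -> (g l == y) = (l == x).
  by move=> <-; rewrite (inj_eq (@perm_inj _ g)).
case c1: (is_cyc3 i j k g).
  have /and4P[/eqP gi /eqP gj /eqP gk _] := c1; congr (_ * _).
  by rewrite !inE (step _ _ gi) (step _ _ gj) (step _ _ gk) orbC -orbA.
case c2: (is_cyc3 k j i g); last by rewrite subrr !mul0r.
have /and4P[/eqP gk /eqP gj /eqP gi _] := c2; congr (_ * _).
by rewrite !inE (step _ _ gi) (step _ _ gj) (step _ _ gk) orbA orbC.
Qed.

Lemma kappaL_1 (a b : K) i j l : kappaL a b 1 i j l = 0.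
Proof.
rewrite /kappaL; case: eqP => // /eqP ij; rewrite big1 // => k /andP[ki kj].
rewrite /is_cyc3 !perm1 (negbTE ij) [j == i]eq_sym (negbTE ij).
by rewrite andbF subrr mul0r.
Qed.
End Classification.

Theorem theorem3p2 (R : realType) (n : nat) : (3 <= n)%N ->
  (forall a b c : R[i],
     DOA (@kappaL R[i] n a b) (@kappaC R[i] n a b c)) /\
  (forall (kL : {perm 'I_n} -> 'I_n -> 'I_n -> 'I_n -> R[i])
          (kC : {perm 'I_n} -> 'I_n -> 'I_n -> R[i]),
     alternatingL kL -> alternatingC kC ->
     ((DOA kL kC
       /\ (forall g i j l, kL g i j (g l) = kL g i j l)
       /\ (forall i j l, kL 1%g i j l = 0))
      <-> exists a b c : R[i],
            kL = @kappaL R[i] n a b /\ kC = @kappaC R[i] n a b c)).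
Proof.
move=> n3; split=> [a b c|kL kC altL altC]; first exact: family_DOA.
split=> [[doa [fixL offL]]|[a [b [c [-> ->]]]]]; last first.
  split; first exact: family_DOA.
  by split=> *; [apply: kappaL_fixed | apply: kappaL_1].
have [a [b EL]] := solveL altL doa fixL offL n3.
have {EL} EL : kL = @kappaL R[i] n a b by do 4!apply: boolp.funext => ?; apply: EL.
rewrite EL in doa.
have [c EC] := solveC n3 altC doa (@family_DOA _ _ a b 0 n3).
exists a, b, c; split=> //.
by do 3!apply: boolp.funext => ?; apply: EC.
Qed.
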